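(* Let $C_0\in \mathrm{Sym}^+(\mathcal H)\cap \mathrm{Tr}(\mathcal H)$ with $\ker(C_0)=\{0\}$. Let $A,B\in \mathrm{Tr}(\mathcal H,C_0)$ with $B=A^{1/2}(I-S)A^{1/2}$, $S\in \mathrm{SymHS}(\mathcal H)_{<I}$. Then $$\lim_{\gamma\to0^+}\|\log[(A+\gamma I)^{-1/2}(B+\gamma I)(A+\gamma I)^{-1/2}]\|_{\mathrm{HS}}=\|\log(I-S)\|_{\mathrm{HS}}.$$
   Context: $\mathcal H$ is a real separable Hilbert space with $\dim\mathcal H=\infty$. $\mathrm{Sym}(\mathcal H)$, $\mathrm{Sym}^+(\mathcal H)$ are the bounded self-adjoint, resp. self-adjoint positive ($\langle Ax,x\rangle\ge0$) operators; $\mathrm{Tr}(\mathcal H)$, $\mathrm{HS}(\mathcal H)$ the trace class and Hilbert-Schmidt operators, $\|\cdot\|_{\mathrm{HS}}$ the Hilbert-Schmidt norm. $A>0$ means $A$ self-adjoint with $\langle x,Ax\rangle>0$ for $x\neq0$. $\mathrm{SymHS}(\mathcal H)_{<I}=\{S\in \mathrm{Sym}(\mathcal H)\cap \mathrm{HS}(\mathcal H): I-S>0\}$. $\mathrm{Tr}(\mathcal H,C_0)=\{C_0^{1/2}(I-S)C_0^{1/2}:S\in \mathrm{SymHS}(\mathcal H)_{<I}\}$. For any $A,B\in \mathrm{Tr}(\mathcal H,C_0)$ there exists $S\in \mathrm{SymHS}(\mathcal H)_{<I}$ with $B=A^{1/2}(I-S)A^{1/2}$. *)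

(* Defs.v *)
From HB Require Import structures.
From mathcomp Require Export all_boot all_order all_algebra.
From mathcomp Require Export all_classical all_reals all_analysis.

Set Implicit Arguments.
Unset Strict Implicit.
Unset Printing Implicit Defensive.

Export Order.TTheory GRing.Theory Num.Theory.
Export numFieldNormedType.Exports.

Local Open Scope classical_set_scope.
Local Open Scope ring_scope.

HB.mixin Record CompleteNormedModule_isHilbert (R : realType) H
    & CompleteNormedModule R H := {
  dot : H -> H -> R ;
  dotC : forall x y, dot x y = dot y x ;
  dot_linearl : forall z a x y, dot (a *: x + y) z = a * dot x z + dot y z ;
  dotxx : forall x, dot x x = `|x| ^+ 2
}.

#[short(type="hilbertType")]
HB.structure Definition Hilbert (R : realType) :=
  { H of CompleteNormedModule_isHilbert R H & CompleteNormedModule R H }.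

Definition separable (T : topologicalType) : Prop :=
  exists D : set T, countable D /\ dense D.

Definition infinite_dimensional (R : realType) (V : lmodType R) : Prop :=
  forall (n : nat) (v : 'I_n -> V),
    ~ (forall x : V, exists c : 'I_n -> R, x = \sum_(i < n) c i *: v i).

Definition orthonormal_basis (R : realType) (H : hilbertType R)
    (e : nat -> H) : Prop :=
  (forall i j, dot (e i) (e j) = (i == j)%:R) /\
  (forall x, series (fun k => dot x (e k) *: e k) @ \oo --> x).

(* A fixed orthonormal basis: one indexed by nat exists as soon as H is
   separable and infinite-dimensional. The trace and Hilbert-Schmidt norms
   below do not depend on which one is chosen. *)
Definition onb (R : realType) (H : hilbertType R) : nat -> H :=
  xget (fun=> 0) (@orthonormal_basis R H).

(* Operators are everywhere-defined functions H -> H, so two operators are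
   equal iff they agree pointwise; composition is \o. *)
Definition bounded_op (R : realType) (H : hilbertType R) (A : H -> H) : Prop :=
  linear A /\ continuous A.

Definition Sym (R : realType) (H : hilbertType R) (A : H -> H) : Prop :=
  bounded_op A /\ forall x y, dot (A x) y = dot x (A y).

Definition SymP (R : realType) (H : hilbertType R) (A : H -> H) : Prop :=
  Sym A /\ forall x, 0 <= dot (A x) x.

Definition pos_op (R : realType) (H : hilbertType R) (A : H -> H) : Prop :=
  Sym A /\ forall x, x != 0 -> 0 < dot x (A x).

(* In the definite descriptions below, the value is the zero operator when
   there is no operator with the stated property. *)
Definition adj_op (R : realType) (H : hilbertType R) (A : H -> H) : H -> H :=
  xget (fun=> 0) [set B | bounded_op B /\ forall x y, dot (A x) y = dot x (B y)].

Definition sqrt_op (R : realType) (H : hilbertType R) (A : H -> H) : H -> H :=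
  xget (fun=> 0) [set Q | SymP Q /\ Q \o Q = A].

Definition inv_op (R : realType) (H : hilbertType R) (A : H -> H) : H -> H :=
  xget (fun=> 0) [set B | [/\ bounded_op B, B \o A = idfun & A \o B = idfun]].

(* For bounded L the series also converges in operator norm, to the same
   operator as this pointwise sum. *)
Definition exp_op (R : realType) (H : hilbertType R) (L : H -> H) : H -> H :=
  fun x => limn (series (fun n => (n`!%:R)^-1 *: iter n L x)).

(* The inverse of exp_op on Sym, where it is injective. Its image consists of
   the self-adjoint T with <Tx, x> >= c |x|^2 for some c > 0; in particular it
   contains I - S for S compact self-adjoint with I - S > 0. *)
Definition log_op (R : realType) (H : hilbertType R) (T : H -> H) : H -> H :=
  xget (fun=> 0) [set L | Sym L /\ exp_op L = T].

Definition trace_norm (R : realType) (H : hilbertType R) (A : H -> H) : \bar R :=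
  (\sum_(0 <= k <oo)
     (dot (sqrt_op (adj_op A \o A) (onb H k)) (onb H k))%:E)%E.

Definition Tr (R : realType) (H : hilbertType R) (A : H -> H) : Prop :=
  bounded_op A /\ (trace_norm A < +oo)%E.

(* Extended-real valued: +oo when A is not Hilbert-Schmidt. *)
Definition HS_norm (R : realType) (H : hilbertType R) (A : H -> H) : \bar R :=
  sqrte (\sum_(0 <= k <oo) (`|A (onb H k)| ^+ 2)%:E)%E.

Definition HS (R : realType) (H : hilbertType R) (A : H -> H) : Prop :=
  bounded_op A /\ (HS_norm A < +oo)%E.

Definition SymHS_ltI (R : realType) (H : hilbertType R) (S : H -> H) : Prop :=
  [/\ Sym S, HS S & pos_op (idfun \- S)].

Definition Tr_rel (R : realType) (H : hilbertType R) (C0 A : H -> H) : Prop :=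
  exists S, SymHS_ltI S /\
    A = sqrt_op C0 \o (idfun \- S) \o sqrt_op C0.

(* Main.v *)
Require Import Defs.
From mathcomp Require Import ring lra.

(* Write [K = A^{1/2} (A + gamma)^{-1/2}]. The functional calculus of [A] gives
   [(A + gamma)^{-1/2} (B + gamma) (A + gamma)^{-1/2} = I - K S K], where [K] is
   a self-adjoint contraction and [K -> I] strongly since [A] is injective.
   As [S] is Hilbert-Schmidt, [K S K -> S] in Hilbert-Schmidt norm. Moreover
   [c <= I - S <= M] for some [c > 0], and then [c <= I - K S K <= M] too if
   [c <= 1 <= M], so it suffices that [log] be Lipschitz in Hilbert-Schmidt norm
   on operators with these bounds. This follows without spectral theorem from
   [log T = lim 2^n (T^{1/2^n} - I)]: the square root is [1 / (2 sqrt c)]-Lipschitz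
   on operators bounded below by [c], and the product of these constants along
   [c, c^{1/2}, c^{1/4}, ...] telescopes to at most [1 / (2^n c)]. *)

Set Implicit Arguments.
Unset Strict Implicit.
Unset Printing Implicit Defensive.

Local Open Scope classical_set_scope.
Local Open Scope ring_scope.

(** * Self-adjoint operators and their quadratic forms *)

(** Strict positivity of [I - S] gives no lower bound [c] by itself, and the slope of the logarithm
    is unbounded near 0. The bound comes from [S] being Hilbert-Schmidt, by the same smallness
    argument that yields [K S -> S]: an operator that is small on a dense range becomes small in
    Hilbert-Schmidt norm once composed with [S]. For [K - I] the dense range is that of [A^{1/2}],
    where [|(K - I) A^{1/2} z| <= sqrt gamma * |z|] because [(A + gamma) - A = gamma] factors
    through the commuting roots; density comes from the injectivity of [A], inherited from [C0].
    Roots, inverses and logarithms are definite descriptions, so each has to be constructed before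
    it can be estimated. The constructions are iterations majorized by scalar sequences, so every
    estimate is proved on the iterates and passes to a pointwise limit, under which Hilbert-Schmidt
    bounds are lower semicontinuous. *)

Section InnerProduct.
Context {R : realType} {H : hilbertType R}.
Implicit Types (a b c d r s M : R) (x y z u v : H).
Implicit Types (A B D F K L Q S T X Y Z : H -> H).

Lemma dotDl x y z : dot (x + y) z = dot x z + dot y z.
Proof. by have := dot_linearl z 1 x y; rewrite scale1r mul1r. Qed.

Lemma dot0l z : dot 0 z = 0.
Proof. by apply: (addrI (dot 0 z)); rewrite -dotDl !addr0. Qed.

Lemma dotZl a x z : dot (a *: x) z = a * dot x z.
Proof. by have := dot_linearl z a x 0; rewrite dot0l !addr0. Qed.

Lemma dotNl x z : dot (- x) z = - dot x z.
Proof. by rewrite -scaleN1r dotZl mulN1r. Qed.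

Lemma dotBl x y z : dot (x - y) z = dot x z - dot y z.
Proof. by rewrite dotDl dotNl. Qed.

Lemma dotDr x y z : dot x (y + z) = dot x y + dot x z.
Proof. by rewrite !(dotC x) dotDl. Qed.

Lemma dot0r x : dot x 0 = 0.
Proof. by rewrite dotC dot0l. Qed.

Lemma dotZr a x z : dot x (a *: z) = a * dot x z.
Proof. by rewrite !(dotC x) dotZl. Qed.

Lemma dotNr x z : dot x (- z) = - dot x z.
Proof. by rewrite !(dotC x) dotNl. Qed.

Lemma dotBr x y z : dot x (y - z) = dot x y - dot x z.
Proof. by rewrite dotDr dotNr. Qed.

Lemma dot_suml n (f : nat -> H) z :
  dot (\sum_(0 <= i < n) f i) z = \sum_(0 <= i < n) dot (f i) z.
Proof.
elim: n => [|n IHn]; first by rewrite !big_geq ?dot0l.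
by rewrite !big_nat_recr //= dotDl IHn.
Qed.

Definition dotE := (dotDl, dotDr, dotNl, dotNr, dotZl, dotZr, dot0l, dot0r).

Lemma dot_ext x y : (forall z, dot x z = dot y z) -> x = y.
Proof.
move=> xy; apply/eqP; rewrite -subr_eq0 -normr_eq0 -sqrf_eq0 -dotxx dotBl xy.
by rewrite subrr.
Qed.

(** Linearity is a consequence ([selfadj_linear]) and boundedness is carried separately by [nbound],
    which keeps its constant explicit. *)
Definition selfadj A := forall x y, dot (A x) y = dot x (A y).

Definition lbound c A := forall x, c * `|x| ^+ 2 <= dot (A x) x.

Definition nbound a A := forall x, `|A x| <= a * `|x|.

Lemma selfadj_linear A : selfadj A -> linear A.
Proof.
by move=> sA a x y; apply: dot_ext => z; rewrite sA !dotE -!sA.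
Qed.

Section Linear.
Variable A : H -> H.
Hypothesis lA : linear A.

Lemma linD x y : A (x + y) = A x + A y.
Proof. by have := lA 1 x y; rewrite !scale1r. Qed.

Lemma lin0 : A 0 = 0.
Proof. by apply: (addrI (A 0)); rewrite -linD !addr0. Qed.

Lemma linZ a x : A (a *: x) = a *: A x.
Proof. by have := lA a x 0; rewrite lin0 !addr0. Qed.

Lemma linN x : A (- x) = - A x.
Proof. by rewrite -scaleN1r linZ scaleN1r. Qed.

Lemma linB x y : A (x - y) = A x - A y.
Proof. by rewrite linD linN. Qed.

Lemma lin_sum n (f : nat -> H) :
  A (\sum_(0 <= i < n) f i) = \sum_(0 <= i < n) A (f i).
Proof.
elim: n => [|n IHn]; first by rewrite !big_geq ?lin0.
by rewrite !big_nat_recr //= linD IHn.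
Qed.
End Linear.

Lemma lbound_dot_ge0 A : lbound 0 A -> forall x, 0 <= dot (A x) x.
Proof. by move=> A0 x; have := A0 x; rewrite mul0r. Qed.

Lemma lbound_le c c' A : c <= c' -> lbound c' A -> lbound c A.
Proof. move=> cc' h x; apply: le_trans (h x); by apply: ler_wpM2r; rewrite ?sqr_ge0. Qed.

Lemma nbound_le c c' A : c <= c' -> nbound c A -> nbound c' A.
Proof. move=> cc' h x; apply: le_trans (h x) _; exact: ler_wpM2r. Qed.

Lemma CauchySchwarz_form A x y : selfadj A -> lbound 0 A ->
  dot (A x) y ^+ 2 <= dot (A x) x * dot (A y) y.
Proof.
move=> sA /lbound_dot_ge0 A0.
set p := dot (A x) x; set q := dot (A x) y; set r := dot (A y) y.
have quad t : 0 <= p + 2 * t * q + t ^+ 2 * r.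
  have := A0 (x + t *: y); rewrite (linD (selfadj_linear sA)).
  rewrite (linZ (selfadj_linear sA)) !dotE (dotC (A y) x) -sA -/p -/q -/r.
  by congr (0 <= _); ring.
have p0 : 0 <= p by exact: A0.
have r0 : 0 <= r by exact: A0.
have [r_eq0|r_neq0] := eqVneq r 0.
  have [->|q0] := eqVneq q 0; first by rewrite expr0n mulr_ge0.
  (* With [r = 0] the quadratic is affine in [t], and this value of [t] brings it to [-1]. *)
  have := quad (- (p + 1) / (2 * q)).
  have -> : p + 2 * (- (p + 1) / (2 * q)) * q + (- (p + 1) / (2 * q)) ^+ 2 * r = -1.
    by rewrite r_eq0; field.
  by rewrite ler0N1.
have r_gt0 : 0 < r by rewrite lt_def r_neq0.
have := quad (- q / r).
have -> : p + 2 * (- q / r) * q + (- q / r) ^+ 2 * r = (p * r - q ^+ 2) / r by field.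
by rewrite pmulr_lge0 ?invr_gt0// subr_ge0.
Qed.

Lemma dot_le x y : dot x y <= `|x| * `|y|.
Proof.
apply: (le_trans (ler_norm _)).
rewrite -(@ler_pXn2r _ 2) ?nnegrE ?mulr_ge0// real_normK ?num_real// exprMn.
rewrite -!dotxx; apply: (@CauchySchwarz_form idfun) => // z.
by rewrite mul0r dotxx sqr_ge0.
Qed.

Lemma norm_dot x y : `|dot x y| <= `|x| * `|y|.
Proof. by rewrite ler_norml dot_le andbT lerNl -dotNl -(normrN x) dot_le. Qed.

Lemma lbound_norm A c x : lbound c A -> c * `|x| <= `|A x|.
Proof.
move=> h; have [->|x0] := eqVneq `|x| 0; first by rewrite mulr0.
have x_gt0 : 0 < `|x| by rewrite lt_def x0 /=.
rewrite -(ler_pM2r x_gt0) -mulrA -expr2; exact: le_trans (h x) (dot_le _ _).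
Qed.

Lemma nbound_dot A a x : nbound a A -> dot (A x) x <= a * `|x| ^+ 2.
Proof.
by move=> h; apply: (le_trans (dot_le _ _)); rewrite expr2 mulrA; exact: ler_wpM2r.
Qed.

(* Cauchy-Schwarz for the form of [A] at [x] and [A x]. *)
Lemma sqr_norm_le_form A a x : selfadj A -> lbound 0 A ->
  (forall y, dot (A y) y <= a * `|y| ^+ 2) -> `|A x| ^+ 2 <= a * dot (A x) x.
Proof.
move=> sA A0 Aa; have [->|Ax0] := eqVneq (`|A x| ^+ 2) 0.
  have [a0|a0] := leP 0 a; first by rewrite mulr_ge0 ?lbound_dot_ge0.
  have := lbound_dot_ge0 A0 x; have := Aa x; have := sqr_ge0 `|x|.
  move=> *; nra.
have Ax_gt0 : 0 < `|A x| ^+ 2 by rewrite lt_def Ax0 sqr_ge0.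
rewrite -(ler_pM2r Ax_gt0) -expr2 -{1}dotxx.
apply: (le_trans (CauchySchwarz_form x (A x) sA A0)).
apply: le_trans (ler_wpM2l (lbound_dot_ge0 A0 x) (Aa (A x))) _.
by rewrite mulrCA mulrA.
Qed.

(** For a nonnegative form, [|A x|^2 <= a <A x, x> <= a^2 |x|^2]. *)
Lemma nbound_of_form A a : 0 <= a -> selfadj A -> lbound 0 A ->
  (forall y, dot (A y) y <= a * `|y| ^+ 2) -> nbound a A.
Proof.
move=> a0 sA A0 Aa x; rewrite -(@ler_pXn2r _ 2) ?nnegrE ?mulr_ge0//.
apply: (le_trans (sqr_norm_le_form x sA A0 Aa)).
by rewrite exprMn [a ^+ 2]expr2 -mulrA; exact: ler_wpM2l.
Qed.

Lemma nbound_continuous A a : linear A -> nbound a A -> continuous A.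
Proof.
move=> lA bA x; apply/cvgrPdist_le => e e0.
have [a0|a0] := leP a 0.
  near=> t; rewrite -(linB lA); apply: (le_trans (bA _)).
  by apply: le_trans (ltW e0); rewrite mulr_le0_ge0.
near=> t; rewrite -(linB lA); apply: (le_trans (bA _)).
rewrite mulrC -ler_pdivlMr//; near: t.
exact: (@cvgr_dist_le _ _ _ _ _ id x cvg_id _ (divr_gt0 e0 a0)).
Unshelve. all: end_near. Qed.

(** If [|A x| <= 1] on the ball of radius [d], rescaling to norm [d / 2] gives the constant [2 / d].
    It is raised to at least 1 because the upper bounds [M] used for roots and logarithms must
    satisfy [1 <= M]. *)
Lemma continuous_nbound A : linear A -> continuous A -> exists2 a, 1 <= a & nbound a A.
Proof.
move=> lA cA; have /cvgrPdist_le/(_ 1 ltr01) := cA 0.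
rewrite (lin0 lA) => /nbhs_norm0P [d /= d0 hd].
exists (Num.max 1 (2 / d)); first by rewrite le_max lexx.
move=> x; apply: (@le_trans _ _ (2 / d * `|x|)); last first.
  by apply: ler_wpM2r => //; rewrite le_max lexx orbT.
have [->|x0] := eqVneq x 0; first by rewrite (lin0 lA) !normr0 mulr0.
have x_gt0 : 0 < `|x| by rewrite normr_gt0.
set k := d / 2 / `|x|; have k0 : 0 <= k by rewrite !divr_ge0 ?ltW.
have kx : `|k *: x| = d / 2 by rewrite normrZ ger0_norm// divfK ?gt_eqF.
have := hd (k *: x); rewrite /= sub0r normrN (linZ lA) kx normrZ ger0_norm//.
move=> /(_ ltac:(lra)) h.
rewrite -(@ler_pM2l _ k) ?divr_gt0//.
apply: (le_trans h); rewrite le_eqVlt; apply/orP; left; apply/eqP.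
by rewrite /k; field; rewrite !gt_eqF.
Qed.

Lemma selfadj_Sym A a : selfadj A -> nbound a A -> Sym A.
Proof.
move=> sA bA; split => //; split; first exact: selfadj_linear.
exact: nbound_continuous (selfadj_linear sA) bA.
Qed.

Lemma selfadj_SymP A a : selfadj A -> nbound a A -> lbound 0 A -> SymP A.
Proof. by move=> sA bA A0; split; [exact: selfadj_Sym bA|exact: lbound_dot_ge0]. Qed.

Lemma SymP_selfadj A : SymP A -> selfadj A. Proof. by case=> -[]. Qed.

Lemma SymP_lbound A : SymP A -> lbound 0 A.
Proof. by case=> _ h x; rewrite mul0r. Qed.

Lemma Sym_nbound A : Sym A -> exists2 a, 1 <= a & nbound a A.
Proof. by case=> -[lA cA] _; exact: continuous_nbound. Qed.

Lemma cvg_dotl (u : nat -> H) x y : u @ \oo --> x -> (fun n => dot (u n) y) @ \oo --> dot x y.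
Proof.
move=> ux; apply/cvgrPdist_le => e e0; near=> n.
rewrite -dotBl; apply: (le_trans (norm_dot _ _)).
apply: (@le_trans _ _ (`|x - u n| * (`|y| + 1))).
  by apply: ler_wpM2l => //; rewrite lerDl.
have y1 : 0 < `|y| + 1 by rewrite ltr_wpDl.
rewrite -ler_pdivlMr//; near: n.
by apply: cvgr_dist_le => //; exact: divr_gt0.
Unshelve. all: end_near. Qed.

Lemma selfadj_lim (F : nat -> H -> H) A : (forall n, selfadj (F n)) ->
  (forall x, F n x @[n --> \oo] --> A x) -> selfadj A.
Proof.
move=> sF FA x y.
have h1 : (fun n => dot (F n x) y) @ \oo --> dot (A x) y by exact: cvg_dotl.
have h2 : (fun n => dot (F n x) y) @ \oo --> dot x (A y).
  rewrite (_ : (fun n => _) = (fun n => dot (F n y) x)); last first.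
    by apply/funext => n; rewrite sF dotC.
  by rewrite dotC; exact: cvg_dotl.
exact: (cvg_unique _ h1 h2).
Qed.

Lemma norm_lim_le (u : nat -> H) x a :
  u @ \oo --> x -> (forall n, `|u n| <= a) -> `|x| <= a.
Proof.
move=> ux ua; have h : (fun n => `|u n|) @ \oo --> `|x| by exact: cvg_norm.
rewrite -(cvg_lim _ h)//; apply: limr_le; first by apply/cvg_ex; exists `|x|.
by near=> n.
Unshelve. all: end_near. Qed.

Lemma linear_lim (F : nat -> H -> H) A : (forall n, linear (F n)) ->
  (forall x, F n x @[n --> \oo] --> A x) -> linear A.
Proof.
move=> lF FA a x y; apply: cvg_unique (FA _) _ => //.
rewrite (_ : (fun n => _) = (fun n => a *: F n x + F n y)); last first.
  by apply/funext => n; rewrite lF.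
by apply: cvgD (FA y); apply: cvgZr; exact: FA.
Qed.

End InnerProduct.

(** * Pointwise limits of operators and the square root iteration *)

Section PointwiseLimits.
Context {R : realType} {H : hilbertType R}.
Implicit Types (a b c d r s M : R) (x y z u v : H).
Implicit Types (A B D F K L Q S T X Y Z : H -> H).

(** The increments of [F] are dominated by those of a bounded monotone scalar sequence, so their
    series converges absolutely. The second conclusion bounds the tail and provides the rate of
    convergence to the logarithm. *)
Lemma pointwise_limit (F : nat -> H -> H) (m : nat -> R) b :
    nondecreasing_seq m -> (forall n, m n <= b) ->
    (forall n x, `|F n.+1 x - F n x| <= (m n.+1 - m n) * `|x|) ->
  exists2 A : H -> H, forall x, F n x @[n --> \oo] --> A x &
    forall n x, `|A x - F n x| <= (b - m n) * `|x|.
Proof.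
move=> m_nd mb dF.
have incr n k x : `|F (n + k)%N x - F n x| <= (m (n + k)%N - m n) * `|x|.
  elim: k => [|k IHk]; first by rewrite addn0 !subrr normr0 mul0r.
  rewrite addnS -(subrK (F (n + k)%N x) (F (n + k).+1 x)) -addrA.
  apply: (le_trans (ler_normD _ _)); apply: (le_trans (lerD (dF _ _) IHk)).
  by rewrite -mulrDl addrA subrK.
have cm : cvgn m.
  by apply: nondecreasing_is_cvgn => //; exists b => _ [n _ <-].
have cF x : cvgn (fun n => F n x).
  have : cvgn (series (telescope (fun n => F n x))).
    apply: normed_cvg; apply: (@series_le_cvg _ _ (fun n => telescope m n * `|x|)).
    - by move=> n; exact: normr_ge0.
    - by move=> n; rewrite /telescope mulr_ge0// subr_ge0 m_nd.
    - by move=> n; exact: dF.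
    - rewrite (_ : series _ = (fun n => series (telescope m) n * `|x|)).
        apply: is_cvgM; last exact: is_cvg_cst.
        rewrite telescopeK; apply: is_cvgB => //; exact: is_cvg_cst.
      by apply/funext => n; rewrite /series /= mulr_suml.
  rewrite telescopeK => h.
  rewrite (_ : (fun n => _) = (fun n => (F n x - F 0%N x) + F 0%N x)).
    by apply: is_cvgD => //; exact: is_cvg_cst.
  by apply/funext => n; rewrite subrK.
exists (fun x => limn (fun n => F n x)) => // n x.
apply: (@norm_lim_le _ _ (fun k => F (k + n)%N x - F n x)).
  apply: cvgB; last exact: cvg_cst.
  by rewrite (cvg_shiftn n (fun k => F k x)); exact: cF.
move=> k; rewrite addnC; apply: (le_trans (incr _ _ _)).
by apply: ler_wpM2r => //; rewrite lerD2r.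
Qed.

Lemma cvg_comp_op A (u : nat -> H) x : continuous A ->
  u @ \oo --> x -> (fun n => A (u n)) @ \oo --> A x.
Proof. by move=> cA ux; apply: continuous_cvg => //; exact: cA. Qed.

(** The uniform bound [a] is what makes application jointly continuous for strong convergence: [|A x
    - F_n u_n| <= |A x - F_n x| + a |x - u_n|]. *)
Lemma cvg_op_app (F : nat -> H -> H) A a (u : nat -> H) x :
    (forall n, linear (F n)) -> (forall n, nbound a (F n)) -> 0 <= a ->
    F n x @[n --> \oo] --> A x -> u @ \oo --> x ->
  (fun n => F n (u n)) @ \oo --> A x.
Proof.
move=> lF bF a0 FA ux; apply/cvgrPdist_le => e e0.
have a1 : 0 < a + 1 by rewrite ltr_wpDl.
have e1 : 0 < e / 2 / (a + 1) by rewrite divr_gt0// divr_gt0.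
near=> n; rewrite -(subrK (F n x) (A x)) -addrA -(linB (lF n)).
apply: (le_trans (ler_normD _ _)); rewrite [leRHS]splitr lerD//.
  near: n; apply: cvgr_dist_le => //; exact: divr_gt0.
apply: (le_trans (bF _ _)); apply: (@le_trans _ _ ((a + 1) * `|x - u n|)).
  by apply: ler_wpM2r => //; rewrite lerDl.
by rewrite mulrC -ler_pdivlMr//; near: n; exact: cvgr_dist_le.
Unshelve. all: end_near. Qed.

Lemma nbound_lim (F : nat -> H -> H) A a : (forall n, nbound a (F n)) ->
  (forall x, F n x @[n --> \oo] --> A x) -> nbound a A.
Proof. by move=> bF FA x; apply: norm_lim_le (FA x) _ => n; exact: bF. Qed.

(* The iteration for [Y = (X + Y^2) / 2], whose solution gives
   [(I - Y)^2 = I - X]; its scalar version [sqrt_iterR] majorizes it. *)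
Fixpoint sqrt_iter X n : H -> H :=
  if n is m.+1
  then fun x => 2^-1 *: (X x + sqrt_iter X m (sqrt_iter X m x)) else fun=> 0.

Fixpoint sqrt_iterR r n : R :=
  if n is m.+1 then 2^-1 * (r + sqrt_iterR r m ^+ 2) else 0.

(** [1 - s] is the smaller root of [y = (1 - s^2 + y^2) / 2], so the iteration started at 0 never
    passes it. *)
Lemma sqrt_iterR_bound s n : 0 <= s <= 1 ->
  0 <= sqrt_iterR (1 - s ^+ 2) n <= 1 - s.
Proof.
move=> /andP[s0 s1]; elim: n => [|n /andP[y0 y1]] /=; first by rewrite lexx subr_ge0.
set y := sqrt_iterR _ _ in y0 y1 *.
have : y ^+ 2 <= (1 - s) ^+ 2 by rewrite ler_pXn2r ?nnegrE ?subr_ge0.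
have := sqr_ge0 y; move=> *; apply/andP; split; nra.
Qed.

Lemma sqrt_iterR_nd s : 0 <= s <= 1 -> nondecreasing_seq (sqrt_iterR (1 - s ^+ 2)).
Proof.
move=> s01; apply/nondecreasing_seqP; elim=> [|n IHn].
  by have /andP[] := sqrt_iterR_bound 1 s01.
have /andP[y0 _] := sqrt_iterR_bound n s01.
by rewrite /= ler_pM2l// lerD2l ler_pXn2r ?nnegrE// (le_trans y0).
Qed.

Section SqrtIter.
Variables (X : H -> H) (s : R).
Hypotheses (sX : selfadj X) (s01 : 0 <= s <= 1) (bX : nbound (1 - s ^+ 2) X).
Local Notation Y := (sqrt_iter X).
Local Notation y := (sqrt_iterR (1 - s ^+ 2)).

Lemma sqrt_iter_linear n : linear (Y n).
Proof.
elim: n => [|n IHn] a u v /=; first by rewrite scaler0 addr0.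
rewrite (selfadj_linear sX) !IHn !scalerDr !scalerA [2^-1 * a]mulrC.
by rewrite addrACA.
Qed.

Lemma sqrt_iter_selfadj n : selfadj (Y n).
Proof.
elim: n => [|n IHn] u v /=; first by rewrite !dotE.
by rewrite !dotE sX !IHn.
Qed.

(** The iterates are polynomials in [X]. With [Z] an iterate this makes the iterates commute with
    each other; with a general [Z] it passes to the limit and gives the commutation property of the
    square root. *)
Lemma sqrt_iter_comm Z n x : linear Z -> (forall u, Z (X u) = X (Z u)) ->
  Z (Y n x) = Y n (Z x).
Proof.
move=> lZ ZX; elim: n x => [|n IHn] x /=; first by rewrite (lin0 lZ).
by rewrite (linZ lZ) (linD lZ) ZX !IHn.
Qed.

Lemma sqrt_iter_nbound n : nbound (y n) (Y n).
Proof.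
elim: n => [|n IHn] x /=; first by rewrite normr0 mul0r.
have /andP[y0 _] := sqrt_iterR_bound n s01.
rewrite normrZ ger0_norm// -mulrA ler_pM2l// mulrDl.
apply: (le_trans (ler_normD _ _)); rewrite lerD//.
by rewrite expr2 -mulrA; apply: (le_trans (IHn _)); exact: ler_wpM2l.
Qed.

(** As the iterates commute, [Y_{n+1}^2 - Y_n^2 = (Y_{n+1} + Y_n)(Y_{n+1} - Y_n)]. The scalar
    iteration factors in the same way, so the domination propagates by induction. *)
Lemma sqrt_iter_diff n x : `|Y n.+1 x - Y n x| <= (y n.+1 - y n) * `|x|.
Proof.
elim: n x => [|n IHn] x; first by have := sqrt_iter_nbound 1 x; rewrite /= !subr0.
have YY u : Y n.+1 (Y n u) = Y n (Y n.+1 u).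
  apply/esym; apply: sqrt_iter_comm => [|v]; first exact: sqrt_iter_linear.
  by apply/esym; apply: sqrt_iter_comm => //; exact: selfadj_linear.
have -> : Y n.+2 x - Y n.+1 x =
    2^-1 *: (Y n.+1 (Y n.+1 x - Y n x) + Y n (Y n.+1 x - Y n x)).
  rewrite [in LHS]/= -/(Y n.+1) -scalerBr opprD addrACA subrr add0r.
  rewrite !(linB (sqrt_iter_linear _)) YY.
  by rewrite addrA subrK.
have /andP[y0 _] := sqrt_iterR_bound n s01.
have /andP[y1 _] := sqrt_iterR_bound n.+1 s01.
have -> : (y n.+2 - y n.+1) * `|x| = 2^-1 * (y n.+1 * ((y n.+1 - y n) * `|x|)
    + y n * ((y n.+1 - y n) * `|x|)).
  have yS m : y m.+1 = 2^-1 * (1 - s ^+ 2 + y m ^+ 2) by [].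
  have -> : y n.+2 - y n.+1 = 2^-1 * (y n.+1 ^+ 2 - y n ^+ 2).
    by rewrite (yS n.+1) {2}(yS n); ring.
  by ring.
rewrite normrZ ger0_norm// ler_pM2l//.
apply: (le_trans (ler_normD _ _)); rewrite lerD//.
  by apply: (le_trans (sqrt_iter_nbound _ _)); apply: ler_wpM2l.
by apply: (le_trans (sqrt_iter_nbound _ _)); apply: ler_wpM2l.
Qed.

(** The bound [1 - s] on the limit is kept because it turns into the lower bound [sqrt c] of the
    square root. *)
Lemma sqrt_iter_lim : exists Y' : H -> H,
  [/\ forall x, Y n x @[n --> \oo] --> Y' x, selfadj Y', nbound (1 - s) Y' &
      forall x, Y' x = 2^-1 *: (X x + Y' (Y' x))].
Proof.
have y_le n : y n <= 1 - s by have /andP[] := sqrt_iterR_bound n s01.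
have bY n : nbound (1 - s) (Y n) by apply: nbound_le (y_le n) _; exact: sqrt_iter_nbound.
have [Y' cY _] := pointwise_limit (sqrt_iterR_nd s01) y_le sqrt_iter_diff.
exists Y'; split => //.
- by apply: selfadj_lim cY; exact: sqrt_iter_selfadj.
- exact: nbound_lim bY cY.
- move=> x; have h : (fun n => Y n.+1 x) @ \oo --> Y' x.
    by rewrite (cvg_shiftS (fun n => Y n x)); exact: cY.
  apply: (cvg_unique _ h) => //=; apply: cvgZr; apply: cvgD; first exact: cvg_cst.
  apply: (@cvg_op_app _ _ (1 - s)) => //; first exact: sqrt_iter_linear.
  by rewrite subr_ge0; case/andP: s01.
Qed.

End SqrtIter.
End PointwiseLimits.

(** * Square roots *)

Section SquareRoots.
Context {R : realType} {H : hilbertType R}.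
Implicit Types (a b c d r s M : R) (x y z u v : H).
Implicit Types (A B D F K L Q S T X Y Z : H -> H).

(** The order interval [c I <= T <= M I]. The value [c = 0] is allowed, so that positive operators
    without a spectral gap, such as [A] and [C0], are covered too. *)
Definition bounds c M T :=
  [/\ 0 <= c, c <= M, 0 < M & selfadj T] /\
  forall x, c * `|x| ^+ 2 <= dot (T x) x <= M * `|x| ^+ 2.

Lemma bounds_lbound c M T : bounds c M T -> lbound c T.
Proof. by move=> [_ h] x; have /andP[] := h x. Qed.

Lemma bounds_lbound0 c M T : bounds c M T -> lbound 0 T.
Proof. by move=> h; apply: lbound_le (bounds_lbound h); case: h => -[]. Qed.

Lemma bounds_nbound c M T : bounds c M T -> nbound M T.
Proof.
move=> h; apply: nbound_of_form (bounds_lbound0 h) _; case: h => -[] //.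
  by move=> *; exact: ltW.
by move=> _ _ _ _ h x; have /andP[] := h x.
Qed.

Lemma bounds_SymP c M T : bounds c M T -> SymP T.
Proof.
move=> h; apply: selfadj_SymP (bounds_nbound h) (bounds_lbound0 h).
by case: h => -[].
Qed.

Lemma SymP_bounds T : SymP T -> exists2 M, 1 <= M & bounds 0 M T.
Proof.
move=> pT; have [M M1 bT] := Sym_nbound pT.1.
have M0 : 0 < M by apply: lt_le_trans M1.
exists M => //; split; first by split; [|exact: ltW| |exact: SymP_selfadj].
by move=> x; rewrite mul0r nbound_dot// andbT; case: pT.
Qed.

(** This is [X] in [T = M (I - X)]: the root of [T] is [sqrt M (I - Y)] with [(I - Y)^2 = I - X].
    The same [X] drives the Neumann series and the power iteration for dense ranges. *)
Definition sqrt_gap M T x := x - M^-1 *: T x.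

Section SquareRoot.
Variables (c M : R) (T : H -> H).
Hypothesis hT : bounds c M T.

Let M0 : 0 < M. Proof. by case: hT => -[]. Qed.
Let c0 : 0 <= c. Proof. by case: hT => -[]. Qed.
Let sT : selfadj T. Proof. by case: hT => -[]. Qed.
Let lT : linear T. Proof. exact: selfadj_linear. Qed.

Let s := Num.sqrt (c / M).

Lemma sqrt_ratio_itv : 0 <= s <= 1.
Proof.
rewrite sqrtr_ge0 /s -[leRHS]sqrtr1 ler_wsqrtr// ler_pdivrMr// mul1r.
by case: hT => -[].
Qed.

Lemma sqr_sqrt_ratio : s ^+ 2 = c / M.
Proof. by rewrite sqr_sqrtr// divr_ge0// ltW. Qed.

Lemma sqrt_gap_selfadj : selfadj (sqrt_gap M T).
Proof. by move=> x y; rewrite /sqrt_gap !dotE sT. Qed.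

Lemma sqrt_gap_nbound : nbound (1 - s ^+ 2) (sqrt_gap M T).
Proof.
have /andP[s0 s1] := sqrt_ratio_itv.
have E x : dot (sqrt_gap M T x) x = `|x| ^+ 2 - M^-1 * dot (T x) x.
  by rewrite /sqrt_gap !dotE dotxx.
apply: nbound_of_form; first by rewrite subr_ge0 expr_le1.
- exact: sqrt_gap_selfadj.
- move=> x; rewrite mul0r E subr_ge0 mulrC ler_pdivrMr// mulrC.
  by case: hT => _ /(_ x)/andP[].
- move=> x; rewrite E mulrBl mul1r lerD2l lerN2 sqr_sqrt_ratio.
  rewrite mulrAC mulrC ler_pM2l ?invr_gt0//.
  by case: hT => _ /(_ x)/andP[].
Qed.

(** The commutation clause serves uniqueness and the joint manipulation of the roots of [A] and
    [A + gamma]; the limit clause lets estimates on the iterates reach the root. *)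
Lemma sqrt_exists : exists Q, [/\ selfadj Q, lbound (Num.sqrt c) Q,
  forall x, Q (Q x) = T x & forall Z, linear Z -> continuous Z ->
    (forall x, Z (T x) = T (Z x)) -> forall x, Z (Q x) = Q (Z x)] /\
  forall x, Num.sqrt M *: (x - sqrt_iter (sqrt_gap M T) n x) @[n --> \oo] --> Q x.
Proof.
have [Y [cY sY bY YE]] := sqrt_iter_lim sqrt_gap_selfadj sqrt_ratio_itv sqrt_gap_nbound.
have cQ x : Num.sqrt M *: (x - sqrt_iter (sqrt_gap M T) n x) @[n --> \oo] -->
    Num.sqrt M *: (x - Y x).
  by apply: cvgZr; apply: cvgB; [exact: cvg_cst|exact: cY].
exists (fun x => Num.sqrt M *: (x - Y x)); split => //; split.
- by move=> x y; rewrite !dotE sY.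
- move=> x; rewrite !dotE dotxx.
  have -> : Num.sqrt c = Num.sqrt M * s.
    by rewrite -sqrtrM ?ltW// mulrC divfK// gt_eqF.
  rewrite -mulrA ler_wpM2l ?sqrtr_ge0//.
  have := nbound_dot x bY; move=> *; lra.
- move=> x; have lY := selfadj_linear sY.
  rewrite (linZ lY) (linB lY) -scalerBr scalerA -expr2 sqr_sqrtr ?ltW//.
  have -> : T x = M *: x - M *: sqrt_gap M T x.
    by rewrite /sqrt_gap scalerBr scalerA mulfV ?gt_eqF// scale1r subKr.
  have -> : sqrt_gap M T x = 2 *: Y x - Y (Y x).
    by rewrite {1}YE scalerA mulfV// scale1r addrK.
  by apply: dot_ext => z; rewrite !dotE; ring.
- move=> Z lZ cZ ZT x.
  have h1 : (fun n => Z (Num.sqrt M *: (x - sqrt_iter (sqrt_gap M T) n x))) @ \oo -->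
      Z (Num.sqrt M *: (x - Y x)).
    by apply: cvg_comp_op => //; exact: cQ.
  apply: cvg_unique h1 _ => //.
  rewrite (_ : (fun n => _) =
    (fun n => Num.sqrt M *: (Z x - sqrt_iter (sqrt_gap M T) n (Z x)))); first exact: cQ.
  apply/funext => n; rewrite (linZ lZ) (linB lZ); congr (_ *: (_ - _)).
  apply: sqrt_iter_comm => // u.
  by rewrite /sqrt_gap (linB lZ) (linZ lZ) ZT.
Qed.

(* Both roots commute, so [(Q - P)Q(Q - P) + (Q - P)P(Q - P) = 0] and both
   summands, being nonnegative, vanish. *)
Lemma sqrt_unique Q P : SymP Q -> selfadj P -> lbound 0 P ->
  (forall x, Q (Q x) = P (P x)) -> (forall x, Q (P x) = P (Q x)) -> Q = P.
Proof.
move=> /[dup] /SymP_selfadj sQ /SymP_lbound Q0 sP P0 QP comm.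
have lQ := selfadj_linear sQ; have lP := selfadj_linear sP.
pose D x := Q x - P x.
have sD : selfadj D by move=> x y; rewrite /D !dotE sQ sP.
have lD := selfadj_linear sD.
have z x : Q (D x) + P (D x) = 0.
  by rewrite /D (linB lQ) (linB lP) QP comm addrA subrK subrr.
have QD x : Q (D x) = 0.
  have h1 := lbound_dot_ge0 Q0 (D x); have h2 := lbound_dot_ge0 P0 (D x).
  have h3 : dot (Q (D x)) (D x) = 0.
    apply/eqP; rewrite eq_le h1 andbT.
    by have := congr1 (fun u => dot u (D x)) (z x); rewrite dotDl dot0l => *; lra.
  apply: dot_ext => y; rewrite dot0l; apply/eqP; rewrite -sqrf_eq0 eq_le sqr_ge0 andbT.
  by apply: (le_trans (CauchySchwarz_form _ _ sQ Q0)); rewrite h3 mul0r.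
have PD x : P (D x) = 0 by have := z x; rewrite QD add0r.
apply/funext => x; apply/eqP; rewrite -subr_eq0 -/(D x) -normr_eq0 -sqrf_eq0 -dotxx sD.
by rewrite {1}/D QD PD subrr dot0r.
Qed.

End SquareRoot.

Lemma nbound_root c M T Q : bounds c M T -> selfadj Q -> (forall x, Q (Q x) = T x) ->
  nbound (Num.sqrt M) Q.
Proof.
move=> hT sQ QQ x; rewrite -(@ler_pXn2r _ 2) ?nnegrE ?mulr_ge0 ?sqrtr_ge0//.
rewrite exprMn sqr_sqrtr; last by case: hT => -[_ _ /ltW].
by rewrite -dotxx -sQ QQ; case: hT => _ /(_ x)/andP[].
Qed.

(** Any other candidate [Q'] commutes with [T = Q' \o Q'], hence with the constructed root, and
    [sqrt_unique] identifies the two. *)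
Lemma sqrt_opP c M T (Q := sqrt_op T) : bounds c M T ->
  [/\ selfadj Q, lbound (Num.sqrt c) Q,
    forall x, Q (Q x) = T x & forall Z, linear Z -> continuous Z ->
    (forall x, Z (T x) = T (Z x)) -> forall x, Z (Q x) = Q (Z x)] /\
  forall x, Num.sqrt M *: (x - sqrt_iter (sqrt_gap M T) n x) @[n --> \oo] --> Q x.
Proof.
move=> hT; have [P [[sP cP PP commP] limP]] := sqrt_exists hT.
have P0 : lbound 0 P by apply: lbound_le cP; exact: sqrtr_ge0.
suff -> : Q = P by split.
have bP := nbound_root hT sP PP.
apply: xget_unique => /=.
  split; last by apply/funext.
  exact: selfadj_SymP bP P0.
move=> Q' [pQ QQ]; apply: sqrt_unique => //.
  by move=> x; rewrite PP -QQ.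
apply: commP; [by case: pQ => -[] []|by case: pQ => -[] []|].
by move=> x; rewrite -QQ.
Qed.

End SquareRoots.

(** * Hilbert-Schmidt bounds *)

Section HilbertSchmidtBounds.
Context {R : realType} {H : hilbertType R}.
Implicit Types (a b c d r s M : R) (x y z u v : H).
Implicit Types (A B D F K L Q S T X Y Z : H -> H).

(** Minkowski's inequality, from [(p + q)^2 <= (1 + b/a) p^2 + (1 + a/b) q^2]: the weights are
    chosen so that the right-hand sides add up to [(a + b)^2]. They require [a, b > 0], whence the
    perturbation by [e]. *)
Lemma sum_sqr_normD n (f g : nat -> H) a b : 0 <= a -> 0 <= b ->
  \sum_(0 <= k < n) `|f k| ^+ 2 <= a ^+ 2 -> \sum_(0 <= k < n) `|g k| ^+ 2 <= b ^+ 2 ->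
  \sum_(0 <= k < n) `|f k + g k| ^+ 2 <= (a + b) ^+ 2.
Proof.
move=> a0 b0 fa gb.
suff key e : 0 < e -> \sum_(0 <= k < n) `|f k + g k| ^+ 2 <= (a + e + (b + e)) ^+ 2.
  apply/ler_addgt0Pr => e e0.
  (* For [d <= 1], [(a + b + 2 d)^2 - (a + b)^2 = 4 d (a + b) + 4 d^2 <= d k]. *)
  set k := 4 * (a + b + 1).
  have k0 : 0 < k by rewrite /k; lra.
  pose d := Num.min 1 (e / k).
  have d0 : 0 < d by rewrite lt_min ltr01 divr_gt0.
  have d1 : d <= 1 by rewrite ge_min lexx.
  have dk : d * k <= e by rewrite -ler_pdivlMr// ge_min lexx orbT.
  apply: (le_trans (key d d0)).
  by move: dk; rewrite /k => dk; nra.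
move=> e0; set a' := a + e; set b' := b + e.
have a'0 : 0 < a' by rewrite /a'; lra.
have b'0 : 0 < b' by rewrite /b'; lra.
apply: (@le_trans _ _ ((1 + b' / a') * \sum_(0 <= k < n) `|f k| ^+ 2 +
    (1 + a' / b') * \sum_(0 <= k < n) `|g k| ^+ 2)).
  rewrite !mulr_sumr -big_split /=; apply: ler_sum => k _.
  set p := `|f k|; set q := `|g k|.
  have : `|f k + g k| ^+ 2 <= (p + q) ^+ 2.
    have pq : `|f k + g k| <= p + q by exact: ler_normD.
    by rewrite !expr2 ler_pM.
  move=> /le_trans; apply.
  rewrite -subr_ge0 (_ : _ - _ = (b' * p - a' * q) ^+ 2 / (a' * b')).
    by rewrite divr_ge0 ?sqr_ge0// mulr_ge0// ltW.
  by field; rewrite !gt_eqF.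
have -> : (a' + b') ^+ 2 = (1 + b' / a') * a' ^+ 2 + (1 + a' / b') * b' ^+ 2.
  by field; rewrite !gt_eqF.
have aa : a ^+ 2 <= a' ^+ 2 by rewrite !expr2 ler_pM// /a'; lra.
have bb : b ^+ 2 <= b' ^+ 2 by rewrite !expr2 ler_pM// /b'; lra.
have p0 : 0 <= b' / a' by rewrite divr_ge0// ltW.
have q0 : 0 <= a' / b' by rewrite divr_ge0// ltW.
apply: lerD; (apply: ler_wpM2l; first by rewrite addr_ge0).
  exact: le_trans aa.
exact: le_trans bb.
Qed.

Section HilbertSchmidt.
Variable e : nat -> H.

(** A bound on the Hilbert-Schmidt norm expressed on finite partial sums, so that all estimates stay
    in [R] rather than in the extended reals. *)
Definition HSbound a D :=
  0 <= a /\ forall n, \sum_(0 <= k < n) `|D (e k)| ^+ 2 <= a ^+ 2.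

Lemma HSbound_le a b D : a <= b -> HSbound a D -> HSbound b D.
Proof.
move=> ab [a0 h]; split; first exact: le_trans ab.
move=> n; apply: (le_trans (h n)); rewrite ler_pXn2r ?nnegrE//; exact: le_trans ab.
Qed.

Lemma HSbound_add a b D F : HSbound a D -> HSbound b F ->
  HSbound (a + b) (fun x => D x + F x).
Proof.
move=> [a0 hD] [b0 hF]; split; first exact: addr_ge0.
by move=> n; apply: sum_sqr_normD.
Qed.

(** A factor on the left is estimated termwise; a factor on the right is reached through
    [HSbound_adj]. *)
Lemma HSbound_left a b D F : 0 <= b -> nbound b F -> HSbound a D ->
  HSbound (b * a) (F \o D).
Proof.
move=> b0 bF [a0 hD]; split; first exact: mulr_ge0.
move=> n; rewrite exprMn; apply: le_trans (ler_wpM2l (sqr_ge0 b) (hD n)).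
rewrite mulr_sumr; apply: ler_sum => k _ /=.
by rewrite -exprMn ler_pXn2r ?nnegrE ?mulr_ge0.
Qed.

Lemma HSbound_scale a b D : HSbound a D -> HSbound (`|b| * a) (fun x => b *: D x).
Proof. by apply: (@HSbound_left _ _ _ ( *:%R b)) => // x; rewrite normrZ. Qed.

Lemma HSbound_opp a D : HSbound a D -> HSbound a (fun x => - D x).
Proof.
move=> hD; rewrite -[a]mul1r -(normrN1 R).
rewrite (_ : (fun x => _) = (fun x => -1 *: D x)); first exact: HSbound_scale.
by apply/funext => x; rewrite scaleN1r.
Qed.

(** Each finite sum is continuous under pointwise convergence, so a uniform bound survives although
    the convergence is only strong. *)
Lemma HSbound_lim a (F : nat -> H -> H) D : (forall n, HSbound a (F n)) ->
  (forall x, F n x @[n --> \oo] --> D x) -> HSbound a D.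
Proof.
move=> hF FD; split; first by case: (hF 0%N).
move=> n.
have h : (fun m => \sum_(0 <= k < n) `|F m (e k)| ^+ 2) @ \oo -->
    \sum_(0 <= k < n) `|D (e k)| ^+ 2.
  elim: n => [|n IHn].
    rewrite big_geq// (_ : (fun m => _) = cst 0); first exact: cvg_cst.
    by apply/funext => m; rewrite big_geq.
  rewrite big_nat_recr//= (_ : (fun m => _) =
    (fun m => \sum_(0 <= k < n) `|F m (e k)| ^+ 2 + `|F m (e n)| ^+ 2)); last first.
    by apply/funext => m; rewrite big_nat_recr.
  apply: cvgD => //; rewrite expr2.
  rewrite (_ : (fun m => _) = (fun m => `|F m (e n)| * `|F m (e n)|)).
    by apply: cvgM; apply: cvg_norm; exact: FD.
  by apply/funext => m; rewrite expr2.
rewrite -(cvg_lim _ h)//; apply: limr_le; first by apply/cvg_ex; eexists; exact: h.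
by near=> m; case: (hF m).
Unshelve. all: end_near. Qed.

Hypothesis he : orthonormal_basis e.

Lemma Parseval x : (fun n => \sum_(0 <= k < n) dot x (e k) ^+ 2) @ \oo --> `|x| ^+ 2.
Proof.
rewrite -dotxx; case: he => _ /(_ x) h.
rewrite (_ : (fun n => _) = (fun n => dot (series (fun k => dot x (e k) *: e k) n) x)).
  exact: cvg_dotl.
apply/funext => n; rewrite /series/= dot_suml; apply: eq_bigr => k _.
by rewrite dotZl expr2 [dot (e k) x]dotC.
Qed.

Lemma Bessel x n : \sum_(0 <= k < n) dot x (e k) ^+ 2 <= `|x| ^+ 2.
Proof.
rewrite -(cvg_lim _ (@Parseval x))//.
apply: (@nondecreasing_cvgn_le _ (fun n => \sum_(0 <= k < n) dot x (e k) ^+ 2)).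
  apply/nondecreasing_seqP => m; rewrite big_nat_recr//= lerDl; exact: sqr_ge0.
by apply/cvg_ex; eexists; exact: Parseval.
Qed.

(** [<F e_k, e_j> = <e_k, D e_j>], so both norms come from the same double array: Parseval expands
    the rows, the finite sums are exchanged, and Bessel bounds the columns. *)
Lemma HSbound_adj a D F : (forall x y, dot (D x) y = dot x (F y)) ->
  HSbound a D -> HSbound a F.
Proof.
move=> DF [a0 hD]; split => // n.
have h : (fun m => \sum_(0 <= k < n) \sum_(0 <= j < m) dot (F (e k)) (e j) ^+ 2) @ \oo
    --> \sum_(0 <= k < n) `|F (e k)| ^+ 2.
  elim: n => [|n IHn].
    rewrite big_geq// (_ : (fun m => _) = cst 0); first exact: cvg_cst.
    by apply/funext => m; rewrite big_geq.
  rewrite big_nat_recr//= (_ : (fun m => _) =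
    (fun m => \sum_(0 <= k < n) \sum_(0 <= j < m) dot (F (e k)) (e j) ^+ 2
       + \sum_(0 <= j < m) dot (F (e n)) (e j) ^+ 2)); last first.
    by apply/funext => m; rewrite big_nat_recr.
  by apply: cvgD => //; exact: Parseval.
rewrite -(cvg_lim _ h)//; apply: limr_le; first by apply/cvg_ex; eexists; exact: h.
near=> m; rewrite exchange_big_nat/=; apply: le_trans (hD m).
apply: ler_sum => j _; apply: le_trans (Bessel _ n).
by apply: ler_sum => k _; rewrite DF dotC.
Unshelve. all: end_near. Qed.

(** By Parseval [|F y|^2] is the sum of the [<y, D e_k>^2], each at most [|y|^2 |D e_k|^2]. *)
Lemma HSbound_adj_nbound a D F : (forall x y, dot (D x) y = dot x (F y)) ->
  HSbound a D -> nbound a F.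
Proof.
move=> DF [a0 hD] y; rewrite -(@ler_pXn2r _ 2) ?nnegrE ?mulr_ge0//.
have h := @Parseval (F y).
rewrite -(cvg_lim _ h)//; apply: limr_le; first by apply/cvg_ex; eexists; exact: h.
near=> n; rewrite exprMn; apply: le_trans (ler_wpM2r (sqr_ge0 `|y|) (hD n)).
rewrite mulr_suml; apply: ler_sum => k _.
rewrite dotC -DF -exprMn -[leLHS]real_normK ?num_real// ler_pXn2r ?nnegrE ?mulr_ge0//.
exact: norm_dot.
Unshelve. all: end_near. Qed.

End HilbertSchmidt.
End HilbertSchmidtBounds.

(** * Inverses and dense ranges *)

Section Inverses.
Context {R : realType} {H : hilbertType R}.
Implicit Types (a b c d r s M : R) (x y z u v : H).
Implicit Types (A B D F K L Q S T X Y Z : H -> H).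

Lemma selfadj_inverse T P : selfadj T -> (forall x, T (P x) = x) -> selfadj P.
Proof. by move=> sT TP x y; rewrite -{1}(TP y) -sT TP. Qed.

(* Neumann series of [I - T/M]. *)
Lemma inverse_exists c M T : 0 < c -> bounds c M T ->
  exists P, [/\ selfadj P, nbound c^-1 P, forall x, T (P x) = x & forall x, P (T x) = x].
Proof.
move=> c0 hT.
have [M0 sT] : 0 < M /\ selfadj T by case: hT => -[].
have cM : c <= M by case: hT => -[].
have lT := selfadj_linear sT.
pose r := 1 - c / M.
have r0 : 0 <= r by rewrite subr_ge0 ler_pdivrMr// mul1r.
have r1 : r < 1 by rewrite ltrBlDr ltrDl divr_gt0.
have bX : nbound r (sqrt_gap M T).
  have E x : dot (sqrt_gap M T x) x = `|x| ^+ 2 - M^-1 * dot (T x) x.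
    by rewrite /sqrt_gap !dotE dotxx.
  apply: nbound_of_form => //.
  - exact: sqrt_gap_selfadj hT.
  - move=> x; rewrite mul0r E subr_ge0 mulrC ler_pdivrMr// mulrC.
    by case: hT => _ /(_ x)/andP[].
  - move=> x; rewrite E mulrBl mul1r lerD2l lerN2.
    rewrite mulrAC mulrC ler_pM2l ?invr_gt0//.
    by case: hT => _ /(_ x)/andP[].
have lX : linear (sqrt_gap M T) by apply: selfadj_linear; exact: sqrt_gap_selfadj hT.
pose G := fix G n := if n is m.+1 then fun x => x + sqrt_gap M T (G m x) else fun=> 0 : H.
have dG n x : G n.+1 x - G n x = iter n (sqrt_gap M T) x.
  elim: n x => [|n IHn] x /=; first by rewrite (lin0 lX) addr0 subr0.
  by rewrite opprD addrACA subrr add0r -(linB lX) -IHn.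
have bG n x : `|iter n (sqrt_gap M T) x| <= r ^+ n * `|x|.
  elim: n => [|n IHn] /=; first by rewrite expr0 mul1r.
  by apply: (le_trans (bX _)); rewrite exprS -mulrA; exact: ler_wpM2l.
(* Minus the tail of the geometric series: its increments are [r ^+ n] and it is bounded by 0. *)
pose m n := - (r ^+ n / (1 - r)).
have r1' : 0 < 1 - r by rewrite subr_gt0.
have dm n : m n.+1 - m n = r ^+ n.
  by rewrite /m exprS; field; rewrite gt_eqF.
have mb n : m n <= 0 by rewrite /m oppr_le0 divr_ge0 ?exprn_ge0// ltW.
have mnd : nondecreasing_seq m.
  by apply/nondecreasing_seqP => n; rewrite -subr_ge0 dm exprn_ge0.
have [|W cW _] := @pointwise_limit _ _ G _ _ mnd mb.
  by move=> n x; rewrite dm dG; exact: bG.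
have WE x : W x = x + sqrt_gap M T (W x).
  have h : (fun n => G n.+1 x) @ \oo --> W x.
    by rewrite (cvg_shiftS (fun n => G n x)); exact: cW.
  apply: (cvg_unique _ h) => //=; apply: cvgD; first exact: cvg_cst.
  by apply: cvg_comp_op => //; exact: nbound_continuous bX.
pose P x := M^-1 *: W x.
have TP x : T (P x) = x.
  have /eqP := WE x; rewrite /sqrt_gap addrCA -subr_eq0 opprD addNKr oppr_eq0.
  by rewrite subr_eq0 => /eqP {2}->; rewrite (linZ lT).
have T_inj x y : T x = T y -> x = y.
  move=> Txy; apply/eqP; rewrite -subr_eq0 -normr_le0 -(ler_pM2l c0) mulr0.
  by apply: (le_trans (lbound_norm _ (bounds_lbound hT))); rewrite (linB lT) Txy subrr normr0.
exists P; split => //.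
- exact: selfadj_inverse TP.
- move=> x; rewrite ler_pdivlMl// -{2}(TP x).
  exact: lbound_norm (bounds_lbound hT).
- by move=> x; apply: T_inj; rewrite TP.
Qed.

Lemma inv_op_eq T P b : linear P -> nbound b P ->
  (forall x, T (P x) = x) -> (forall x, P (T x) = x) -> inv_op T = P.
Proof.
move=> lP bP TP PT; apply: xget_unique => /=.
  split; [split=> //; exact: nbound_continuous bP|exact/funext|exact/funext].
move=> B [_ BT _]; apply/funext => x.
by have /= := congr1 (fun f => f (P x)) BT; rewrite TP.
Qed.

(* With [G = I - T/M], [<G^n x, G^m x>] depends on [n + m] only and decreases,
   so [G^n x] converges to a fixed point of [G], which is [0]; moreover
   [x - G^n x] lies in the range of [T]. *)
Lemma dense_range T : SymP T -> (forall x, T x = 0 -> x = 0) ->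
  forall x d, 0 < d -> exists y, `|x - T y| <= d.
Proof.
move=> pT T_inj x d d0.
have [M M1 hT] := SymP_bounds pT.
have M0 : 0 < M by exact: lt_le_trans M1.
have sT := SymP_selfadj pT; have lT := selfadj_linear sT.
pose G := sqrt_gap M T.
have sG : selfadj G by exact: sqrt_gap_selfadj hT.
have lG := selfadj_linear sG.
have bG : nbound 1 G.
  have := sqrt_gap_nbound hT; rewrite (sqr_sqrt_ratio hT) mul0r subr0. exact.
have G0 : lbound 0 G.
  move=> y; rewrite mul0r /G /sqrt_gap !dotE dotxx subr_ge0 mulrC ler_pdivrMr// mulrC.
  by case: hT => _ /(_ y)/andP[].
have G1 y : dot (G y) y <= `|y| ^+ 2.
  by have := nbound_dot y bG; rewrite mul1r.
have GG y : `|G y| ^+ 2 <= dot (G y) y.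
  have := @sqr_norm_le_form _ _ G 1 y sG G0; rewrite mul1r; apply=> z.
  by rewrite mul1r.
pose g n := iter n G x.
have gS n k : dot (g n.+1) (g k) = dot (g n) (g k.+1) by rewrite /g /= sG.
have gadd n k : dot (g n) (g k) = dot (g (n + k)%N) x.
  elim: k n => [|k IHk] n; first by rewrite addn0.
  by rewrite -gS IHk addSnnS.
pose s n := dot (g n) x.
(* [s (k + k)] is [|g k|^2] and [s (k + k).+1] is [<G (g k), g k>], so sign and monotonicity of [s]
   reduce to [0 <= G] and [|G y|^2 <= <G y, y> <= |y|^2]. *)
have parity n : exists k, n = (k + k)%N \/ n = (k + k).+1.
  exists n./2; rewrite addnn -{1 3}(odd_double_half n).
  by case: odd; [right|left].
have s0 n : 0 <= s n.
  have [k [->|->]] := parity n; first by rewrite /s -gadd dotxx sqr_ge0.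
  rewrite /s -addSn -gadd; exact: (lbound_dot_ge0 G0 (g k)).
have sd n : s n.+1 <= s n.
  have [k [->|->]] := parity n; first by rewrite /s -addSn -!gadd dotxx; exact: G1.
  rewrite /s -addSn -gadd -addnS -gadd dotxx; exact: GG.
have cs : cvgn s.
  by apply: nonincreasing_is_cvgn; [exact/nonincreasing_seqP|exists 0 => _ [n _ <-]].
have normg n k : `|g n - g k| ^+ 2 = s (n + n)%N - 2 * s (n + k)%N + s (k + k)%N.
  by rewrite -dotxx !dotE !gadd [(k + n)%N]addnC -/(s _) -/(s _) -/(s _); ring.
have cg : cvgn g.
  apply/cauchy_cvgP/cauchy_exP => e e0.
  (* [|g N - g n|^2] combines three values of [s] with coefficients 1, -2, 1, so their deviations
     from the limit count four times. *)
  have e4 : 0 < (e / 2) ^+ 2 / 4 by rewrite divr_gt0 ?exprn_gt0 ?divr_gt0.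
  have [N _ hN] : \forall n \near \oo, `|limn s - s n| <= (e / 2) ^+ 2 / 4.
    by apply: cvgr_dist_le => //; exact: cs.
  exists (g N); exists N => // n /= Nn; rewrite -ball_normE/=.
  apply: (@le_lt_trans _ _ (e / 2)); last by rewrite ltr_pdivrMr// ltr_pMr// ltr1n.
  have e2 : 0 <= e / 2 by rewrite ltW// divr_gt0.
  suff : `|g N - g n| ^+ 2 <= (e / 2) ^+ 2 by rewrite ler_pXn2r ?nnegrE.
  rewrite normg.
  have h1 : `|limn s - s (N + N)%N| <= (e / 2) ^+ 2 / 4 by apply: hN; rewrite /= leq_addr.
  have h2 : `|limn s - s (N + n)%N| <= (e / 2) ^+ 2 / 4 by apply: hN; rewrite /= leq_addr.
  have h3 : `|limn s - s (n + n)%N| <= (e / 2) ^+ 2 / 4.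
    by apply: hN; rewrite /= (leq_trans Nn)// leq_addr.
  by move: h1 h2 h3; rewrite !ler_norml => /andP[? ?] /andP[? ?] /andP[? ?]; lra.
have cGg : G (limn g) = limn g.
  have h : (fun n => g n.+1) @ \oo --> limn g by rewrite (cvg_shiftS g); exact: cg.
  apply: (cvg_unique _ _ h) => //=; apply: cvg_comp_op; last exact: cg.
  exact: nbound_continuous bG.
have lg0 : limn g = 0.
  apply: T_inj; move: cGg; rewrite /G /sqrt_gap => /eqP.
  rewrite -subr_eq0 addrAC subrr add0r oppr_eq0 scaler_eq0 invr_eq0 gt_eqF//=.
  by move=> /eqP.
have range n : exists y, x - g n = T y.
  elim: n => [|n [y xgy]]; first by exists 0; rewrite subrr (lin0 lT).
  exists (y + M^-1 *: g n); rewrite (linD lT) -xgy (linZ lT).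
  have -> : g n.+1 = g n - M^-1 *: T (g n) by [].
  by rewrite opprB addrCA addrC.
have [n hn] : exists n, `|g n| <= d.
  have [n _ hn] : \forall n \near \oo, `|limn g - g n| <= d by apply: cvgr_dist_le => //; exact: cg.
  by exists n; have := hn n (leqnn n); rewrite /= lg0 sub0r normrN.
by have [y xy] := range n; exists y; rewrite -xy subKr.
Qed.

(** A uniform form of strong convergence: [t] depends on [x] and [d] but not on [F]. Replacing [x]
    by a nearby [Q y] costs at most [2 (d / 4)]. The bound 2 is the one available for [K - I] with
    [K] a contraction. *)
Lemma small_of_dense Q : (forall x d, 0 < d -> exists y, `|x - Q y| <= d) ->
  forall x d, 0 < d -> exists2 t, 0 < t & forall F, linear F -> nbound 2 F ->
    (forall y, `|F (Q y)| <= t * `|y|) -> `|F x| <= d.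
Proof.
move=> dQ x d d0; have [|y xy] := dQ x (d / 4); first exact: divr_gt0.
exists (d / 2 / (`|y| + 1)); first by rewrite !divr_gt0// ltr_wpDl.
move=> F lF bF FQ; rewrite -(subrK (Q y) x) (linD lF).
apply: (le_trans (ler_normD _ _)); rewrite [leRHS]splitr lerD//.
  by apply: (le_trans (bF _)); lra.
apply: (le_trans (FQ _)); rewrite mulrAC ler_pdivrMr ?ltr_wpDl//.
by apply: ler_wpM2l; [exact/ltW/divr_gt0|rewrite lerDl].
Qed.

(** Composition with a Hilbert-Schmidt [S] upgrades strong smallness to Hilbert-Schmidt smallness:
    beyond some rank [N] the sum is controlled by the tail for [S], and the finitely many vectors
    [S (e k)] below [N] are treated one by one. *)
Lemma HSbound_small_of_dense (e : nat -> H) S a Q :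
    (forall x d, 0 < d -> exists y, `|x - Q y| <= d) -> HSbound e a S ->
  forall d, 0 < d -> exists2 t, 0 < t & forall F, linear F -> nbound 2 F ->
    (forall y, `|F (Q y)| <= t * `|y|) -> HSbound e d (F \o S).
Proof.
move=> dQ [a0 hS] d d0.
pose f n : R := \sum_(0 <= k < n) `|S (e k)| ^+ 2.
have f_nd : nondecreasing_seq f.
  apply/nondecreasing_seqP => n; rewrite /f big_nat_recr//= lerDl; exact: sqr_ge0.
have cf : cvgn f by apply: nondecreasing_is_cvgn => //; exists (a ^+ 2) => _ [n _ <-]; exact: hS.
(* Since [|F|^2 <= 4], the tail contributes at most [4 (d^2 / 8)], half of [d^2]; the head gets the
   other half. *)
have d8 : 0 < d ^+ 2 / 8 by rewrite divr_gt0 ?exprn_gt0.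
have [N hN] : exists N, forall n, f n - f N <= d ^+ 2 / 8.
  have [N _ hN] : \forall n \near \oo, `|limn f - f n| <= d ^+ 2 / 8.
    by apply: cvgr_dist_le => //; exact: cf.
  exists N => n; apply: (@le_trans _ _ (limn f - f N)).
    by rewrite lerD2r; exact: nondecreasing_cvgn_le.
  exact: le_trans (ler_norm _) (hN N (leqnn N)).
have head n b : 0 < b -> exists2 t, 0 < t & forall F, linear F -> nbound 2 F ->
    (forall y, `|F (Q y)| <= t * `|y|) -> \sum_(0 <= k < n) `|F (S (e k))| ^+ 2 <= b.
  elim: n b => [|n IHn] b b0; first by exists 1 => // F _ _ _; rewrite big_geq// ltW.
  have [t1 t10 h1] := IHn _ (divr_gt0 b0 (ltr0Sn R 1)).
  have b2 : 0 < Num.sqrt (b / 2) by rewrite sqrtr_gt0 divr_gt0.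
  have [t2 t20 h2] := small_of_dense dQ (S (e n)) b2.
  exists (Num.min t1 t2); first by rewrite lt_min t10 t20.
  move=> F lF bF FQ; rewrite big_nat_recr//= [leRHS]splitr lerD//.
    apply: h1 => // y; apply: (le_trans (FQ y)); apply: ler_wpM2r => //.
    by rewrite ge_min lexx.
  have -> : b / 2 = Num.sqrt (b / 2) ^+ 2 by rewrite sqr_sqrtr// ltW// divr_gt0.
  rewrite ler_pXn2r ?nnegrE ?sqrtr_ge0//.
  apply: h2 => // y; apply: (le_trans (FQ y)); apply: ler_wpM2r => //.
  by rewrite ge_min lexx orbT.
have [t t0 ht] := head N (d ^+ 2 / 2) (divr_gt0 (exprn_gt0 2 d0) (ltr0Sn R 1)).
exists t => // F lF bF FQ; split; first exact: ltW.
have h := ht F lF bF FQ.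
have tail k : `|F (S (e k))| ^+ 2 <= 4 * `|S (e k)| ^+ 2.
  have -> : 4 = 2 ^+ 2 :> R by rewrite expr2; lra.
  by rewrite -exprMn ler_pXn2r ?nnegrE ?mulr_ge0.
move=> n; have [nN|Nn] := leqP n N.
  apply: (@le_trans _ _ (\sum_(0 <= k < N) `|F (S (e k))| ^+ 2)).
    rewrite [leRHS](big_cat_nat (leq0n n) nN)//= lerDl.
    by apply: sumr_ge0 => *; exact: sqr_ge0.
  apply: (le_trans h); have := sqr_ge0 d; lra.
rewrite (big_cat_nat (leq0n N) (ltnW Nn))//=.
have : \sum_(N <= k < n) `|F (S (e k))| ^+ 2 <= 4 * (f n - f N).
  rewrite /f [in leRHS](big_cat_nat (leq0n N) (ltnW Nn))//= addrAC subrr add0r.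
  by rewrite mulr_sumr; apply: ler_sum => k _; exact: tail.
have := hN n => *; lra.
Qed.

End Inverses.

(** * A positive lower bound for [I - S] *)

Section Coercivity.
Context {R : realType} {H : hilbertType R}.
Implicit Types (a b c d r s M : R) (x y z u v : H).
Implicit Types (A B D F K L Q S T X Y Z : H -> H).

Lemma bounds_shift c M t T : 0 <= t -> bounds c M T ->
  bounds (c + t) (M + t) (T \+ t \*: idfun).
Proof.
move=> t0 [[c0 cM M0 sT] h]; split.
  split; [exact: addr_ge0|by rewrite lerD2r|by rewrite ltr_wpDr|].
  by move=> x y /=; rewrite !dotE sT.
by move=> x /=; rewrite !dotE dotxx !mulrDl !lerD2r; exact: h.
Qed.

(* With [T = I - S] and [J = t (T + t)^-1], one has [J = J S + J T], where [J T] is small in norm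
   and [J S] is small in Hilbert-Schmidt norm since [J -> 0] strongly. *)
Lemma pos_op_coercive (e : nat -> H) (he : orthonormal_basis e) S a :
  selfadj S -> HSbound e a S -> pos_op (idfun \- S) ->
  exists c, exists M, [/\ 0 < c, c <= 1, 1 <= M & bounds c M (idfun \- S)].
Proof.
move=> sS hS [symT posT]; set T := idfun \- S.
have pT : SymP T.
  split=> // x; have [->|x0] := eqVneq x 0; first by rewrite dot0r.
  by rewrite dotC ltW// posT.
have sT := SymP_selfadj pT; have lT := selfadj_linear sT.
have T_inj x : T x = 0 -> x = 0.
  by move=> Tx; apply/eqP/negPn/negP => /posT; rewrite -/T Tx dot0r ltxx.
have [M M1 hT] := SymP_bounds pT.
have M0 : 0 < M by exact: lt_le_trans M1.
have q0 : 0 < 4^-1 :> R by rewrite invr_gt0.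
have [t t0 ht] := HSbound_small_of_dense (dense_range pT T_inj) hS q0.
(* [2 g <= t] makes [J] small enough on the range of [T] to obtain [|J S| <= 1/4]; [g <= 1/8] gives
   [|J T| <= 1/4]. Together [|J| <= 1/2]. *)
pose g := Num.min (t / 2) 8^-1.
have g0 : 0 < g by rewrite lt_min divr_gt0//= invr_gt0.
have gt : 2 * g <= t by rewrite mulrC -ler_pdivlMr// ge_min lexx.
have g8 : g <= 8^-1 by rewrite ge_min lexx orbT.
have hTg := bounds_shift (ltW g0) hT; rewrite add0r in hTg.
have [P [sP bP TP PT]] := inverse_exists g0 hTg.
have lP := selfadj_linear sP.
pose J x := g *: P x.
have sJ : selfadj J by move=> x y; rewrite /J !dotE sP.
have lJ := selfadj_linear sJ.
have bJ : nbound 1 J.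
  move=> x; rewrite /J normrZ gtr0_norm// mul1r mulrC -ler_pdivlMr// mulrC.
  exact: bP.
have JT x : `|J (T x)| <= 2 * g * `|x|.
  have -> : J (T x) = g *: (x - J x).
    by rewrite /J -{2}(PT x) /= (linD lP) (linZ lP) addrK.
  rewrite normrZ gtr0_norm// mulrAC [leRHS]mulrC ler_pM2l//.
  by apply: (le_trans (ler_normB _ _)); have := bJ x; lra.
have bJ2 : nbound 2 J by apply: nbound_le bJ; lra.
have hJS : HSbound e 4^-1 (J \o S).
  apply: ht => // x; apply: (le_trans (JT x)); exact: ler_wpM2r.
have adjJS x y : dot (J (S x)) y = dot x (S (J y)) by rewrite sJ sS.
have adjSJ x y : dot (S (J x)) y = dot x (J (S y)) by rewrite sS sJ.
(* [HSbound_adj_nbound] bounds the adjoint of the given operator, so the estimate is first moved to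
   [S J], whose adjoint is [J S]. *)
have bJS : nbound 4^-1 (J \o S).
  exact: (HSbound_adj_nbound he adjSJ (HSbound_adj he adjJS hJS)).
have Jhalf x : `|J x| <= 2^-1 * `|x|.
  have -> : J x = J (S x) + J (T x) by rewrite -(linD lJ) /T /= addrC subrK.
  apply: (le_trans (ler_normD _ _)).
  have := bJS x; have := JT x; have := normr_ge0 x => /= x0 h1 h2.
  have : 2 * g * `|x| <= 4^-1 * `|x| by apply: ler_wpM2r => //; lra.
  lra.
(* [J] sends [(T + g) x] to [g x], so [|J| <= 1/2] gives [g |x| <= (|T x| + g |x|) / 2]. *)
have Tlow x : g * `|x| <= `|T x|.
  have : `|J (T x + g *: x)| <= 2^-1 * (`|T x| + g * `|x|).
    apply: (le_trans (Jhalf _)); rewrite ler_pM2l//.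
    by apply: (le_trans (ler_normD _ _)); rewrite normrZ gtr0_norm.
  have -> : J (T x + g *: x) = g *: x by rewrite /J PT.
  rewrite normrZ gtr0_norm//; lra.
(* The constant comes from [g^2 |x|^2 <= |T x|^2 <= M <T x, x>]. *)
have c0 : 0 < g ^+ 2 / M by rewrite divr_gt0 ?exprn_gt0.
exists (g ^+ 2 / M), M; split => //.
  rewrite ler_pdivrMr// mul1r; apply: le_trans M1.
  by rewrite expr_le1 ?ltW//; lra.
have Tl x : g ^+ 2 / M * `|x| ^+ 2 <= dot (T x) x.
  rewrite mulrAC ler_pdivrMr// mulrC [leRHS]mulrC.
  have := sqr_norm_le_form x sT (bounds_lbound0 hT) (fun y => proj2 (andP (proj2 hT y))).
  apply: le_trans; rewrite mulrC -exprMn ler_pXn2r ?nnegrE// mulr_ge0//.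
  exact: ltW.
split; last by move=> x; rewrite Tl; have /andP[_ ->] := proj2 hT x.
split=> //; first exact: ltW.
rewrite ler_pdivrMr//; apply: (@le_trans _ _ 1).
  by rewrite expr_le1 ?ltW//; lra.
by rewrite -[leLHS]mulr1 ler_pM.
Qed.

(** * The square root is Lipschitz in Hilbert-Schmidt norm *)

Section Lipschitz.
Variables (e : nat -> H) (he : orthonormal_basis e).

(** Both iterations are run with the same [M]. In [Y^2 - Y'^2 = Y (Y - Y') + (Y - Y') Y'] the
    factors [Y], [Y'] have norm at most [1 - s < 1], so the distance of the iterates stays bounded;
    [M] cancels in the final constant. *)
Lemma HSbound_sqrt_op c M d T T' : 0 < c -> bounds c M T -> bounds c M T' ->
  HSbound e d (fun x => T x - T' x) ->
  HSbound e (d / (2 * Num.sqrt c)) (fun x => sqrt_op T x - sqrt_op T' x).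
Proof.
move=> c0 hT hT' hd; have d0 : 0 <= d by case: hd.
have M0 : 0 < M by case: hT => -[].
pose s := Num.sqrt (c / M).
have s0 : 0 < s by rewrite sqrtr_gt0 divr_gt0.
have s01 : 0 <= s <= 1 by exact: sqrt_ratio_itv hT.
(* The fixed point of [h = (d / M + 2 (1 - s) h) / 2], the recursion satisfied by the distance of
   the iterates. *)
pose h := d / M / (2 * s).
have h0 : 0 <= h by rewrite !divr_ge0// ?mulr_ge0// ltW.
pose X := sqrt_gap M T; pose X' := sqrt_gap M T'.
have sX : selfadj X := sqrt_gap_selfadj hT.
have sX' : selfadj X' := sqrt_gap_selfadj hT'.
have hX : HSbound e (d / M) (fun x => X x - X' x).
  rewrite (_ : (fun x => _) = (fun x => - M^-1 *: (T x - T' x))).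
    by have := HSbound_scale (- M^-1) hd; rewrite normrN gtr0_norm ?invr_gt0// mulrC.
  by apply/funext => x; apply: dot_ext => z; rewrite /X /X' /sqrt_gap !dotE; ring.
have Yh n : HSbound e h (fun x => sqrt_iter X n x - sqrt_iter X' n x).
  elim: n => [|n IHn].
    by split=> // m; rewrite big1 ?sqr_ge0// => k _ /=; rewrite subrr normr0 expr0n.
  set Y := sqrt_iter X n in IHn *; set Y' := sqrt_iter X' n in IHn *.
  have lY : linear Y . Proof. exact: sqrt_iter_linear.
  have lY' : linear Y' by exact: sqrt_iter_linear.
  have sY : selfadj Y . Proof. exact: sqrt_iter_selfadj.
  have sY' : selfadj Y' by exact: sqrt_iter_selfadj.
  have /andP[_ yle] := sqrt_iterR_bound n s01.
  have bY : nbound (1 - s) Y.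
    apply: nbound_le yle _; apply: sqrt_iter_nbound => //; exact: sqrt_gap_nbound hT.
  have bY' : nbound (1 - s) Y'.
    apply: nbound_le yle _; apply: sqrt_iter_nbound => //; exact: sqrt_gap_nbound hT'.
  have s1 : 0 <= 1 - s by rewrite subr_ge0; case/andP: s01.
  have h1 := HSbound_left s1 bY IHn.
  (* Here [Y'] stands on the right of the difference; the adjoint puts it on the left. *)
  have h2 : HSbound e ((1 - s) * h) (fun x => Y (Y' x) - Y' (Y' x)).
    apply: (HSbound_adj he (D := Y' \o (fun x => Y x - Y' x))); last exact: HSbound_left.
    by move=> x y /=; rewrite sY' dotBl dotBr sY sY'.
  have := HSbound_scale 2^-1 (HSbound_add hX (HSbound_add h1 h2)).
  have -> : `|2^-1| * (d / M + ((1 - s) * h + (1 - s) * h)) = h.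
    by rewrite ger0_norm// /h; field; rewrite !gt_eqF.
  congr HSbound; apply/funext => x.
  by apply: dot_ext => z; rewrite /= (linB lY) !dotE; ring.
have [_ cQ] := sqrt_opP hT; have [_ cQ'] := sqrt_opP hT'.
have -> : d / (2 * Num.sqrt c) = Num.sqrt M * h.
  have -> : Num.sqrt c = Num.sqrt M * s.
    by rewrite -sqrtrM ?ltW// mulrC divfK// gt_eqF.
  have sM : 0 < Num.sqrt M by rewrite sqrtr_gt0.
  have MM : M = Num.sqrt M ^+ 2 by rewrite sqr_sqrtr// ltW.
  rewrite /h; set r := Num.sqrt M in MM sM *; rewrite MM.
  by field; rewrite !gt_eqF.
apply: (@HSbound_lim _ _ e _ (fun n x => - Num.sqrt M *:
   (sqrt_iter X n x - sqrt_iter X' n x))).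
  by move=> n; have := HSbound_scale (- Num.sqrt M) (Yh n); rewrite normrN ger0_norm ?sqrtr_ge0.
move=> x; rewrite (_ : (fun n => _) = (fun n =>
    Num.sqrt M *: (x - sqrt_iter X n x) - Num.sqrt M *: (x - sqrt_iter X' n x))).
  by apply: cvgB; [exact: cQ|exact: cQ'].
by apply/funext => n; apply: dot_ext => z; rewrite !dotE; ring.
Qed.

End Lipschitz.
End Coercivity.

(** * Exponential *)

Section ExpPoly.
Context {R : realType}.
Local Notation w k := ((k`!%:R)^-1 : R).

Definition exp_poly N : {poly R} := \poly_(i < N) w i.

(** Below degree [N] the square of the truncated exponential has the coefficients of [exp (2 x)], by
    the binomial formula. *)
Lemma exp_poly_sqr_coef N k : (k < N)%N ->
  (exp_poly N * exp_poly N)`_k = 2 ^+ k * w k.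
Proof.
move=> kN; rewrite coefM.
have -> : 2 ^+ k = \sum_(j < k.+1) 'C(k, j)%:R :> R.
  by rewrite -natr_sum -natrX (Pascal 1 1); congr _%:R; apply: eq_bigr => j _;
    rewrite !exp1n !muln1.
rewrite mulr_suml; apply: eq_bigr => -[j /=]; rewrite ltnS => jk _.
rewrite !coef_poly (leq_ltn_trans jk kN) (leq_ltn_trans (leq_subr _ _) kN).
rewrite -(bin_fact jk) !natrM; field.
by rewrite !pnatr_eq0 -!lt0n !fact_gt0 bin_gt0 jk.
Qed.

(** This covers the degrees from [N] on: nonnegativity lets the tail for an operator be dominated by
    the tail for its norm bound. *)
Lemma exp_poly_sqr_coef_ge0 N k : 0 <= (exp_poly N * exp_poly N)`_k.
Proof.
rewrite coefM; apply: sumr_ge0 => j _; rewrite !coef_poly.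
by apply: mulr_ge0; case: ifP => // _; rewrite invr_ge0.
Qed.

(** Values in a module allow both uses, with [iter k L x] in [H] and with [a ^+ k] in [R]. *)
Lemma exp_poly_sqr_sum (V : lmodType R) N (f : nat -> V) :
  \sum_(i < N) \sum_(j < N) (w i * w j) *: f (i + j)%N =
  \sum_(k < N + N) (exp_poly N * exp_poly N)`_k *: f k.
Proof.
have coefE k : (exp_poly N * exp_poly N)`_k =
    \sum_(i < N) \sum_(j < N) (w i * w j) * (k == i + j)%N%:R.
  rewrite /exp_poly poly_def mulr_suml coef_sum; apply: eq_bigr => i _.
  rewrite mulr_sumr coef_sum; apply: eq_bigr => j _.
  by rewrite -scalerAl -scalerAr scalerA -exprD coefZ coefXn.
under [RHS]eq_bigr => k _ do rewrite coefE scaler_suml.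
rewrite [RHS]exchange_big; apply: eq_bigr => i _ /=.
under [RHS]eq_bigr => k _ do rewrite scaler_suml.
rewrite [RHS]exchange_big; apply: eq_bigr => j _ /=.
have ij : (i + j < N + N)%N.
  by apply: (@leq_trans (N + j)); rewrite ?ltn_add2r ?leq_add2l // ltnW.
rewrite (bigD1 (Ordinal ij))//= eqxx mulr1 big1 ?addr0// => k kij.
suff /negbTE -> : (k : nat) != (i + j)%N by rewrite mulr0 scale0r.
by apply: contra kij => /eqP kE; apply/eqP/val_inj.
Qed.
End ExpPoly.

Section Exponential.
Context {R : realType} {H : hilbertType R}.
Implicit Types (a b c d r s M : R) (x y z u v : H).
Implicit Types (A B D F K L Q S T X Y Z : H -> H).
Local Notation w k := ((k`!%:R)^-1 : R).

Definition exp_sum L n x := \sum_(0 <= k < n) w k *: iter k L x.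

Lemma iter_linear L k : linear L -> linear (iter k L).
Proof. by move=> lL; elim: k => [|k IHk] b x y //=; rewrite IHk lL. Qed.

Lemma iter_nbound L a k : 0 <= a -> nbound a L -> nbound (a ^+ k) (iter k L).
Proof.
move=> a0 bL; elim: k => [|k IHk] x /=; first by rewrite expr0 mul1r.
by apply: (le_trans (bL _)); rewrite exprS -mulrA; exact: ler_wpM2l.
Qed.

Lemma iter_selfadj L k : selfadj L -> selfadj (iter k L).
Proof. by move=> sL; elim: k => [|k IHk] x y //=; rewrite sL IHk -iterSr. Qed.

Lemma exp_sum_linear L n : linear L -> linear (exp_sum L n).
Proof.
move=> lL b x y; rewrite /exp_sum scaler_sumr -big_split/=; apply: eq_bigr => k _.
by rewrite (iter_linear k lL) scalerDr !scalerA mulrC.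
Qed.

Lemma exp_partial_le a n : 0 <= a -> \sum_(0 <= k < n) w k * a ^+ k <= expR a.
Proof.
move=> a0; rewrite /expR.
have := @nondecreasing_cvgn_le _ (series (exp_coeff a)) _ _ n; rewrite /series/= => h.
have -> : \sum_(0 <= k < n) w k * a ^+ k = \sum_(0 <= k < n) exp_coeff a k.
  by apply: eq_bigr => k _; rewrite exp_coeffE.
apply: h; last exact: is_cvg_series_exp_coeff.
apply/nondecreasing_seqP => m; rewrite big_nat_recr//= lerDl; exact: exp_coeff_ge0.
Qed.

Lemma exp_sum_norm L a m n x : 0 <= a -> nbound a L ->
  `|\sum_(m <= k < n) w k *: iter k L x| <= (\sum_(m <= k < n) w k * a ^+ k) * `|x|.
Proof.
move=> a0 bL; apply: (le_trans (ler_norm_sum _ _ _)).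
rewrite mulr_suml; apply: ler_sum => k _.
rewrite normrZ ger0_norm ?invr_ge0// -mulrA ler_pM2l ?invr_gt0 ?ltr0n ?fact_gt0//.
exact: iter_nbound.
Qed.

Lemma exp_sum_nbound L a n : 0 <= a -> nbound a L -> nbound (expR a) (exp_sum L n).
Proof.
move=> a0 bL x; apply: (le_trans (exp_sum_norm _ _ x a0 bL)).
by apply: ler_wpM2r => //; exact: exp_partial_le.
Qed.

Section Exp.
Variables (L : H -> H) (a : R).
Hypotheses (a0 : 0 <= a) (bL : nbound a L).

Lemma exp_op_cvg x : exp_sum L n x @[n --> \oo] --> exp_op L x.
Proof.
suff : cvgn (series (fun k => w k *: iter k L x)) by [].
apply: normed_cvg; apply: (@series_le_cvg _ _ (fun k => exp_coeff a k * `|x|)).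
- by move=> k; exact: normr_ge0.
- by move=> k; rewrite mulr_ge0// exp_coeff_ge0.
- move=> k; have := exp_sum_norm k k.+1 x a0 bL; rewrite !big_nat1.
  by rewrite exp_coeffE.
- rewrite (_ : series _ = (fun n => series (exp_coeff a) n * `|x|)).
    by apply: is_cvgM; [exact: is_cvg_series_exp_coeff|exact: is_cvg_cst].
  by apply/funext => n; rewrite /series /= mulr_suml.
Qed.

Lemma exp_op_nbound : nbound (expR a) (exp_op L).
Proof.
apply: (@nbound_lim _ _ (exp_sum L)); first by move=> n; exact: exp_sum_nbound.
exact: exp_op_cvg.
Qed.

(** Taylor remainder of order two; the constant is the crude one given by [(k + 2)! >= k!]. *)
Lemma exp_op_rem x : `|exp_op L x - x - L x| <= a ^+ 2 * expR a * `|x|.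
Proof.
apply: (@norm_lim_le _ _ (fun n => exp_sum L n.+2 x - x - L x)).
  apply: cvgB; last exact: cvg_cst.
  apply: cvgB; last exact: cvg_cst.
  rewrite (cvg_shiftS (fun n => exp_sum L n.+1 x)).
  by rewrite (cvg_shiftS (fun n => exp_sum L n x)); exact: exp_op_cvg.
move=> n; have -> : exp_sum L n.+2 x - x - L x = \sum_(2 <= k < n.+2) w k *: iter k L x.
  rewrite /exp_sum big_nat_recl// big_nat_recl// [in RHS]big_add1 [in RHS]big_add1 /=.
  rewrite invr1 !scale1r.
  by rewrite [x + _]addrC addrK addrC addKr.
apply: (le_trans (exp_sum_norm _ _ x a0 bL)); apply: ler_wpM2r => //.
rewrite big_add1 big_add1 /=.
apply: le_trans (ler_wpM2l (sqr_ge0 a) (exp_partial_le n a0)).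
rewrite mulr_sumr; apply: ler_sum => k _.
have -> : a ^+ k.+2 = a ^+ 2 * a ^+ k by rewrite -exprD.
rewrite mulrCA ler_wpM2l ?sqr_ge0//; apply: ler_wpM2r; first exact: exprn_ge0.
have hf : (k`! <= k.+2`!)%N by rewrite !factS mulnA leq_pmull.
by rewrite lef_pV2 ?posrE ?ltr0n ?fact_gt0// ler_nat.
Qed.

Lemma exp_op_selfadj : selfadj L -> selfadj (exp_op L).
Proof.
move=> sL; apply: (@selfadj_lim _ _ (exp_sum L)); last exact: exp_op_cvg.
move=> n x y; rewrite /exp_sum [RHS]dotC !dot_suml; apply: eq_bigr => k _.
by rewrite !dotZl (iter_selfadj k sL) dotC.
Qed.

End Exp.

(** The squared truncation and the truncation for [2 L] agree below degree [n]. What is left has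
    nonnegative coefficients, so its norm is at most the corresponding scalar difference, which
    tends to [exp(a)^2 - exp(2 a) = 0]. *)
Lemma exp_op_double L a : linear L -> 0 <= a -> nbound a L ->
  forall x, exp_op (fun y => 2 *: L y) x = exp_op L (exp_op L x).
Proof.
move=> lL a0 bL x.
pose L2 y := 2 *: L y.
have lL2 : linear L2 by move=> b u v; rewrite /L2 lL scalerDr !scalerA mulrC.
have bL2 : nbound (2 * a) L2.
  by move=> y; rewrite /L2 normrZ ger0_norm// -mulrA ler_pM2l.
have a20 : 0 <= 2 * a by rewrite mulr_ge0.
have it k y : iter k L2 y = 2 ^+ k *: iter k L y.
  elim: k => [|k IHk] /=; first by rewrite scale1r.
  by rewrite IHk /L2 (linZ lL) scalerA exprS.
have c1 : (fun n => exp_sum L n (exp_sum L n x)) @ \oo --> exp_op L (exp_op L x).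
  apply: (@cvg_op_app _ _ _ _ (expR a)).
  - by move=> n; exact: exp_sum_linear.
  - by move=> n; exact: exp_sum_nbound.
  - exact: expR_ge0.
  - exact: exp_op_cvg a0 bL _.
  - exact: exp_op_cvg a0 bL _.
have c2 := exp_op_cvg a20 bL2 (x := x).
pose p n : R := \sum_(0 <= k < n) w k * a ^+ k.
pose q n : R := \sum_(0 <= k < n) w k * (2 * a) ^+ k.
have diff n : `|exp_sum L n (exp_sum L n x) - exp_sum L2 n x| <= (p n ^+ 2 - q n) * `|x|.
  have E : exp_sum L n (exp_sum L n x) =
      \sum_(k < n + n) (exp_poly n * exp_poly n)`_k *: iter k L x.
    rewrite -exp_poly_sqr_sum /exp_sum big_mkord; apply: eq_bigr => i _.
    rewrite (lin_sum (iter_linear i lL)) big_mkord scaler_sumr.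
    by apply: eq_bigr => j _; rewrite (linZ (iter_linear i lL)) scalerA -iterD.
  have E2 : exp_sum L2 n x = \sum_(0 <= k < n) (exp_poly n * exp_poly n)`_k *: iter k L x.
    rewrite /exp_sum; apply: eq_big_nat => k /andP[_ kn].
    by rewrite it scalerA exp_poly_sqr_coef// mulrC.
  have Ep : p n ^+ 2 = \sum_(k < n + n) (exp_poly n * exp_poly n)`_k * a ^+ k.
    have := @exp_poly_sqr_sum R R^o n (fun k => a ^+ k) => /= <-.
    rewrite /p big_mkord expr2 mulr_suml; apply: eq_bigr => i _.
    rewrite mulr_sumr; apply: eq_bigr => j _.
    by rewrite /GRing.scale/= exprD mulrACA.
  have Eq : q n = \sum_(0 <= k < n) (exp_poly n * exp_poly n)`_k * a ^+ k.
    apply: eq_big_nat => k /andP[_ kn].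
    by rewrite exp_poly_sqr_coef// exprMn; ring.
  rewrite E E2 Ep Eq -!(big_mkord xpredT (fun k => (exp_poly n * exp_poly n)`_k *: iter k L x)).
  rewrite -(big_mkord xpredT (fun k => (exp_poly n * exp_poly n)`_k * a ^+ k)).
  rewrite !(big_cat_nat (leq0n n) (leq_addr n n))/= [X in `|X|]addrAC subrr add0r.
  rewrite [X in _ <= X * _]addrAC subrr add0r.
  apply: (le_trans (ler_norm_sum _ _ _)); rewrite mulr_suml; apply: ler_sum => k _.
  rewrite normrZ ger0_norm ?exp_poly_sqr_coef_ge0// -mulrA.
  by apply: ler_wpM2l; [exact: exp_poly_sqr_coef_ge0|exact: iter_nbound].
have cp : p @ \oo --> expR a.
  rewrite (_ : p = series (exp_coeff a)); first exact: is_cvg_series_exp_coeff.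
  by apply/funext => n; apply: eq_bigr => k _; rewrite exp_coeffE.
have cq : q @ \oo --> expR (2 * a).
  rewrite (_ : q = series (exp_coeff (2 * a))); first exact: is_cvg_series_exp_coeff.
  by apply/funext => n; apply: eq_bigr => k _; rewrite exp_coeffE.
have c0 : (fun n => (p n ^+ 2 - q n) * `|x|) @ \oo --> (0 : R).
  rewrite [X in _ --> X](_ : _ = (expR a * expR a - expR (2 * a)) * `|x|).
    apply: cvgM; last exact: cvg_cst.
    apply: cvgB => //.
    by rewrite (_ : (fun n => _) = (fun n => p n * p n));
      [exact: cvgM|apply/funext => n; rewrite expr2].
  have -> : expR (2 * a) = expR a * expR a by rewrite -expRD; congr expR; ring.
  by rewrite subrr mul0r.
have : (fun n => exp_sum L n (exp_sum L n x) - exp_sum L2 n x) @ \oo --> (0 : H).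
  apply/cvgrPdist_le => d d0; near=> n; rewrite sub0r normrN.
  apply: (le_trans (diff n)); apply: (le_trans (ler_norm _)).
  by near: n; apply: cvgr0_norm_le => //; exact: c0.
move=> c3; apply/esym/eqP; rewrite -subr_eq0; apply/eqP.
by apply: cvg_unique c3 => //; apply: cvgB.
Unshelve. all: end_near. Qed.

Lemma Sym_linear L : Sym L -> linear L. Proof. by case=> -[]. Qed.

Lemma exp_op_half L : Sym L -> forall x,
  exp_op L x = exp_op (fun y => 2^-1 *: L y) (exp_op (fun y => 2^-1 *: L y) x).
Proof.
move=> sL x; have [a a1 bL] := Sym_nbound sL; have lL := Sym_linear sL.
have a0 : 0 <= a by apply: le_trans a1.
rewrite -(@exp_op_double _ (2^-1 * a)).
- by congr (exp_op _ x); apply/funext => y; rewrite scalerA divff// scale1r.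
- by move=> b u v; rewrite lL scalerDr !scalerA mulrC.
- by rewrite mulr_ge0.
- by move=> y; rewrite normrZ ger0_norm// -mulrA ler_pM2l.
Qed.

Lemma Sym_scale t L : Sym L -> Sym (fun y => t *: L y).
Proof.
move=> [[lL cL] sL]; have [a a1 bL] := continuous_nbound lL cL.
apply: (@selfadj_Sym _ _ _ (`|t| * a)); first by move=> x y; rewrite !dotE sL.
by move=> x; rewrite normrZ -mulrA; exact: ler_wpM2l.
Qed.

(** Positivity holds because [exp L] is the square of the self-adjoint [exp (L / 2)]. *)
Lemma exp_op_SymP L : Sym L -> SymP (exp_op L).
Proof.
move=> sL; have [a a1 bL] := Sym_nbound sL; have lL := Sym_linear sL.
have a0 : 0 <= a by apply: le_trans a1.
have sh := Sym_scale 2^-1 sL; have [b b1 bh] := Sym_nbound sh.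
have b0 : 0 <= b by apply: le_trans b1.
apply: selfadj_SymP (exp_op_nbound a0 bL) _.
  by apply: exp_op_selfadj a0 bL _; case: sL.
move=> x; rewrite mul0r exp_op_half// (exp_op_selfadj b0 bh); last by case: sh.
by rewrite dotxx sqr_ge0.
Qed.

Lemma sqrt_op_eq Q T : SymP Q -> (forall x, Q (Q x) = T x) -> sqrt_op T = Q.
Proof.
move=> pQ QQ; have [b b1 bQ] := Sym_nbound pQ.1; have sQ := SymP_selfadj pQ.
have b0 : 0 <= b by apply: le_trans b1.
have pT : SymP T.
  apply: (@selfadj_SymP _ _ _ (b * b)).
  - by move=> x y; rewrite -!QQ !sQ.
  - by move=> x; rewrite -QQ -mulrA; apply: (le_trans (bQ _)); exact: ler_wpM2l.
  - by move=> x; rewrite mul0r -QQ sQ dotxx sqr_ge0.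
have [M _ hT] := SymP_bounds pT; have [[sP cP PP commP] _] := sqrt_opP hT.
apply/esym; apply: sqrt_unique => //.
- by apply: lbound_le cP; exact: sqrtr_ge0.
- by move=> x; rewrite PP QQ.
- by apply: commP; [exact: selfadj_linear|case: pQ => -[] []|move=> x; rewrite -!QQ].
Qed.

Lemma iter_sqrt_exp_op L n : Sym L ->
  iter n (@sqrt_op R H) (exp_op L) = exp_op (fun y => (2 ^+ n)^-1 *: L y).
Proof.
move=> sL; elim: n => [|n IHn] /=.
  by congr exp_op; apply/funext => y; rewrite expr0 invr1 scale1r.
have sn := Sym_scale (2 ^+ n)^-1 sL.
rewrite IHn; apply: sqrt_op_eq; first by apply: exp_op_SymP; exact: Sym_scale.
move=> x; rewrite [RHS]exp_op_half//.
have -> : (fun y => (2 ^+ n.+1)^-1 *: L y) = (fun y => 2^-1 *: ((2 ^+ n)^-1 *: L y)).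
  by apply/funext => y; rewrite scalerA exprS invfM.
by [].
Qed.

Lemma cvg_pow2V a : (fun n => a * (2 ^+ n)^-1) @ \oo --> (0 : R).
Proof.
rewrite -(mulr0 a); apply: cvgMr; rewrite (_ : (fun n => _) = GRing.exp 2^-1).
  by apply: cvg_expr; rewrite ger0_norm// invf_lt1// ltr1n.
by apply/funext => n; rewrite exprVn.
Qed.

(** The iterated roots of [exp L] are [exp (L / 2^n)], whose Taylor remainder is [O(4^-n)]. This
    recovers [L] from [exp L] and so determines the logarithm. *)
Lemma log_limit L x : Sym L ->
  2 ^+ n *: (iter n (@sqrt_op R H) (exp_op L) x - x) @[n --> \oo] --> L x.
Proof.
move=> sL; have [a a1 bL] := Sym_nbound sL; have lL := Sym_linear sL.
have a0 : 0 <= a by apply: le_trans a1.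
apply/cvgrPdist_le => d d0; near=> n; rewrite iter_sqrt_exp_op//.
set t : R := (2 ^+ n)^-1.
have t0 : 0 < t by rewrite invr_gt0 exprn_gt0.
have t1 : t <= 1 by rewrite invf_le1 ?exprn_gt0// exprn_ege1// ler1n.
have bt : nbound (t * a) (fun y => t *: L y).
  by move=> y; rewrite normrZ gtr0_norm// -mulrA ler_pM2l.
have ta : 0 <= t * a by rewrite mulr_ge0// ltW.
have h := exp_op_rem ta bt x.
have -> : 2 ^+ n = t^-1 by rewrite invrK.
move: (exp_op _ x - x) h => E h.
have -> : L x - t^-1 *: E = - (t^-1 *: (E - t *: L x)).
  by rewrite scalerBr scalerA mulVf ?gt_eqF// scale1r opprB.
rewrite normrN normrZ gtr0_norm ?invr_gt0// mulrC ler_pdivrMr//; apply: (le_trans h).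
apply: (@le_trans _ _ (a ^+ 2 * expR a * `|x| * t * t)).
  rewrite (_ : _ * t * t = (t * a) ^+ 2 * expR a * `|x|); last by ring.
  apply: ler_wpM2r => //; apply: ler_wpM2l; first exact: sqr_ge0.
  by rewrite ler_expR ler_piMl.
rewrite ler_pM2r//; apply: (le_trans (ler_norm _)).
by rewrite /t; near: n; apply: cvgr0_norm_le => //; exact: cvg_pow2V.
Unshelve. all: end_near. Qed.

End Exponential.

(** * Logarithm *)

Section Logarithm.
Context {R : realType} {H : hilbertType R}.
Implicit Types (a b c d r s M : R) (x y z u v : H).
Implicit Types (A B D F K L Q S T X Y Z : H -> H).

Fixpoint iter_sqrtR c n : R := if n is m.+1 then Num.sqrt (iter_sqrtR c m) else c.

Lemma iter_sqrtR_itv c n : 0 < c -> c <= 1 -> 0 < iter_sqrtR c n <= 1.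
Proof.
move=> c0 c1; elim: n => [|n /andP[q0 q1]] /=; first by rewrite c0.
by rewrite sqrtr_gt0 q0 -[leRHS]sqrtr1 ler_wsqrtr.
Qed.

(** From [1 <= M] follows [sqrt M <= M], so a single upper bound serves all iterated roots; only the
    lower bound has to be tracked. *)
Lemma sqrt_op_bounds c M T : 0 < c -> c <= 1 -> 1 <= M -> bounds c M T ->
  bounds (Num.sqrt c) M (sqrt_op T).
Proof.
move=> c0 c1 M1 hT; have [[sQ lQ QQ _] _] := sqrt_opP hT.
have M0 : 0 < M by exact: lt_le_trans M1.
have sc1 : Num.sqrt c <= 1 by rewrite -[leRHS]sqrtr1 ler_wsqrtr.
split; first by split; rewrite ?sqrtr_ge0//; exact: le_trans M1.
move=> x; rewrite lQ/=.
apply: le_trans (nbound_dot x (nbound_root hT sQ QQ)) _.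
apply: ler_wpM2r; first exact: sqr_ge0.
have sM : Num.sqrt M ^+ 2 = M by rewrite sqr_sqrtr// ltW.
have sM1 : 1 <= Num.sqrt M by rewrite -[leLHS]sqrtr1 ler_wsqrtr.
by rewrite -{2}sM expr2 ler_peMl// (le_trans ler01).
Qed.

Local Notation droot n T := (iter n (@sqrt_op R H) T).

Lemma iter_sqrt_op_bounds c M T n : 0 < c -> c <= 1 -> 1 <= M -> bounds c M T ->
  bounds (iter_sqrtR c n) M (droot n T).
Proof.
move=> c0 c1 M1 hT; elim: n => [//|n IHn] /=.
by have /andP[q0 q1] := iter_sqrtR_itv n c0 c1; exact: sqrt_op_bounds.
Qed.

(** With [c_{i+1}^2 = c_i], each Lipschitz constant [1 / (2 c_{i+1})] equals [c_{i+1} / (2 c_i)],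
    which is why the product telescopes to [c_n / (2^n c)]. *)
Lemma HSbound_iter_sqrt_op (e : nat -> H) (he : orthonormal_basis e) c M d T T' n :
    0 < c -> c <= 1 -> 1 <= M -> bounds c M T -> bounds c M T' ->
    HSbound e d (fun x => T x - T' x) ->
  HSbound e (iter_sqrtR c n / (2 ^+ n * c) * d) (fun x => droot n T x - droot n T' x).
Proof.
move=> c0 c1 M1 hT hT' hd; elim: n => [|n IHn].
  by rewrite /= expr0 mul1r divff ?gt_eqF// mul1r.
have /andP[q0 q1] := iter_sqrtR_itv n c0 c1.
have := HSbound_sqrt_op he q0 (iter_sqrt_op_bounds n c0 c1 M1 hT)
  (iter_sqrt_op_bounds n c0 c1 M1 hT') IHn.
congr HSbound; rewrite /= exprS.
have r0 : 0 < Num.sqrt (iter_sqrtR c n) by rewrite sqrtr_gt0.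
have rr : iter_sqrtR c n = Num.sqrt (iter_sqrtR c n) ^+ 2 by rewrite sqr_sqrtr// ltW.
set r := Num.sqrt _ in r0 rr *; rewrite rr; field.
by rewrite !gt_eqF// exprn_gt0.
Qed.

Definition log_approx T n x := 2 ^+ n *: (droot n T x - x).

Section Log.
Variables (c M : R) (T : H -> H).
Hypotheses (c0 : 0 < c) (c1 : c <= 1) (M1 : 1 <= M) (hT : bounds c M T).
Let hr n := iter_sqrt_op_bounds n c0 c1 M1 hT.

Lemma root_selfadj n : selfadj (droot n T).
Proof. by case: (hr n) => -[]. Qed.

Lemma rootS n x : droot n.+1 T (droot n.+1 T x) = droot n T x.
Proof. by have [[_ _ QQ _] _] := sqrt_opP (hr n); exact: QQ. Qed.

Lemma log_approx_selfadj n : selfadj (log_approx T n).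
Proof. by move=> x y; rewrite /log_approx !dotE root_selfadj. Qed.

Let k := (M + 1) / c.
Let k0 : 0 <= k. Proof. by rewrite divr_ge0 ?addr_ge0 ?(le_trans ler01 M1)//; exact: ltW. Qed.

(* [Q^2 - I = (Q + I)(Q - I)] and [Q + I >= 2q] when [q <= Q] and [q <= 1]. *)
Lemma log_approx_nbound n : nbound k (log_approx T n).
Proof.
(* The factor [iter_sqrtR c n] is kept in the induction: dividing [q^2] by the [q] gained at the
   next root leaves exactly the next factor. Only at the end is it bounded by 1. *)
have key x : c * `|log_approx T n x| <= iter_sqrtR c n * ((M + 1) * `|x|).
  rewrite /log_approx normrZ ger0_norm ?exprn_ge0//.
  elim: n => [|n IHn].
    rewrite /= expr0 mul1r ler_pM2l// mulrDl mul1r.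
    by apply: (le_trans (ler_normB _ _)); rewrite lerD2r; exact: bounds_nbound hT _.
  set u := droot n.+1 T x - x.
  have /andP[q0 q1] := iter_sqrtR_itv n.+1 c0 c1.
  have /andP[q0' q1'] := iter_sqrtR_itv n c0 c1.
  set q := iter_sqrtR c n.+1 in q0 q1 *.
  have qq : iter_sqrtR c n = q ^+ 2 by rewrite /q/= sqr_sqrtr// ltW.
  have h : 2 * q * `|u| <= `|droot n T x - x|.
    have -> : droot n T x - x = droot n.+1 T u + u.
      by rewrite /u (linB (selfadj_linear (root_selfadj n.+1))) rootS addrA subrK.
    apply: (@lbound_norm _ _ (fun v => droot n.+1 T v + v)) => v.
    rewrite dotDl dotxx; have := bounds_lbound (hr n.+1) v; rewrite -/q => hv.
    have : q * `|v| ^+ 2 <= `|v| ^+ 2 by apply: ler_piMl => //; exact: sqr_ge0.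
    lra.
  have := le_trans (ler_wpM2l (ltW (mulr_gt0 c0 (exprn_gt0 n (ltr0Sn R 1)))) h) _.
  move=> /(_ (q ^+ 2 * ((M + 1) * `|x|))).
  rewrite -mulrA -qq => /(_ IHn); rewrite qq => h'.
  rewrite -(ler_pM2l q0) !mulrA -expr2 -[leRHS]mulrA; apply: le_trans _ h'.
  by rewrite exprS le_eqVlt; apply/orP; left; apply/eqP; ring.
move=> x; rewrite /k mulrAC ler_pdivlMr// mulrC; apply: (le_trans (key x)).
have /andP[q0 q1] := iter_sqrtR_itv n c0 c1.
by rewrite ler_piMl// mulr_ge0// addr_ge0// (le_trans _ M1).
Qed.

(** With [Q = Q_{n+1}] and [Q_n = Q^2], the difference is [- 2^n (Q - I)^2], that is
    [- L_{n+1}^2 / 2^(n+2)] for [L_{n+1} = 2^(n+1) (Q - I)]. *)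
Lemma log_approx_diff n x :
  `|log_approx T n.+1 x - log_approx T n x| <= k ^+ 2 * (2 ^+ n.+2)^-1 * `|x|.
Proof.
have lL : linear (log_approx T n.+1) := selfadj_linear (log_approx_selfadj n.+1).
have lr := selfadj_linear (root_selfadj n.+1).
have -> : log_approx T n.+1 x - log_approx T n x =
    - ((2 ^+ n.+2)^-1 *: log_approx T n.+1 (log_approx T n.+1 x)).
  rewrite {3 4}/log_approx (linZ lr) (linB lr) rootS /log_approx.
  apply: dot_ext => z; rewrite !dotE !exprS; field.
  by rewrite expf_neq0// pnatr_eq0.
rewrite normrN normrZ gtr0_norm ?invr_gt0 ?exprn_gt0//.
rewrite mulrAC [leRHS]mulrC ler_pM2l ?invr_gt0 ?exprn_gt0//.
apply: (le_trans (log_approx_nbound _ _)).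
by apply: (le_trans (ler_wpM2l k0 (log_approx_nbound _ _))); rewrite expr2 mulrA.
Qed.

Lemma log_approx_lim : exists2 L : H -> H,
  forall x, log_approx T n x @[n --> \oo] --> L x &
  forall n x, `|L x - log_approx T n x| <= k ^+ 2 * (2 ^+ n.+1)^-1 * `|x|.
Proof.
pose m n := - (k ^+ 2 * (2 ^+ n.+1)^-1).
have dm n : m n.+1 - m n = k ^+ 2 * (2 ^+ n.+2)^-1.
  by rewrite /m !exprS; field; rewrite expf_neq0// pnatr_eq0.
have pos n : 0 <= k ^+ 2 * (2 ^+ n)^-1 by rewrite mulr_ge0 ?sqr_ge0// invr_ge0 exprn_ge0.
have mb n : m n <= 0 by rewrite /m oppr_le0.
have mnd : nondecreasing_seq m.
  by apply/nondecreasing_seqP => n; rewrite -subr_ge0 dm.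
have [|L cL hL] := @pointwise_limit _ _ (log_approx T) _ _ mnd mb.
  by move=> n x; rewrite dm; exact: log_approx_diff.
by exists L => // n x; have := hL n x; rewrite /m sub0r opprK.
Qed.

Lemma nbound_sqr_diff A B g d : linear A -> nbound g A -> nbound g B -> 0 <= g ->
    (forall x, `|A x - B x| <= d * `|x|) -> 0 <= d ->
  forall x, `|A (A x) - B (B x)| <= 2 * g * d * `|x|.
Proof.
move=> lA bA bB g0 AB d0 x.
rewrite -(subrK (A (B x)) (A (A x))) -addrA -(linB lA).
apply: (le_trans (ler_normD _ _)).
have h1 : `|A (A x - B x)| <= g * (d * `|x|).
  by apply: (le_trans (bA _)); exact: ler_wpM2l.
have h2 : `|A (B x) - B (B x)| <= d * (g * `|x|).
  by apply: (le_trans (AB _)); exact: ler_wpM2l.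
apply: (le_trans (lerD h1 h2)); rewrite le_eqVlt; apply/orP; left; apply/eqP; ring.
Qed.

(* [Q_n = I + L_n / 2^n] and [exp (L / 2^n)] differ by [O(4^-n)]; squaring
   [n] times costs a factor [O(2^n)]. *)
Lemma log_exists : exists L, Sym L /\ exp_op L = T.
Proof.
have [L cL hL] := log_approx_lim.
have sL : selfadj L by apply: selfadj_lim cL; exact: log_approx_selfadj.
have bL : nbound k L by apply: nbound_lim cL; exact: log_approx_nbound.
have SL : Sym L := selfadj_Sym sL bL.
have lL := selfadj_linear sL.
exists L; split => //.
pose E n := exp_op (fun y => (2 ^+ n)^-1 *: L y).
pose t n : R := (2 ^+ n)^-1.
have t0 n : 0 < t n by rewrite invr_gt0 exprn_gt0.
have t1 n : t n <= 1 by rewrite invf_le1 ?exprn_gt0// exprn_ege1// ler1n.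
have tk n : 0 <= t n * k by rewrite mulr_ge0// ltW.
(* A common norm bound for the root [droot n T] and for [E n], chosen so that [g n.+1] squares to
   [g n]. *)
pose g n := expR (t n * k).
have gS n : g n.+1 * g n.+1 = g n.
  rewrite -expRD; congr expR; rewrite /t exprS; field.
  by rewrite expf_neq0// pnatr_eq0.
have g0 n : 0 < g n by exact: expR_gt0.
have g1 n : 1 <= g n by rewrite -[leLHS]expR0 ler_expR.
have bt n : nbound (t n * k) (fun y => t n *: L y).
  by move=> y; rewrite normrZ gtr0_norm// -mulrA ler_pM2l.
have lt n : linear (fun y => t n *: L y).
  by move=> b u v; rewrite lL scalerDr !scalerA mulrC.
have bE n : nbound (g n) (E n) by exact: exp_op_nbound.
have EE n x : E n.+1 (E n.+1 x) = E n x.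
  rewrite /E [RHS]exp_op_half; last exact: Sym_scale.
  have -> : (fun y => (2 ^+ n.+1)^-1 *: L y) = (fun y => 2^-1 *: ((2 ^+ n)^-1 *: L y)).
    by apply/funext => y; rewrite scalerA exprS invfM.
  by [].
have rE n x : droot n T x = x + t n *: log_approx T n x.
  by rewrite /log_approx scalerA mulVf ?gt_eqF ?exprn_gt0// scale1r addrC subrK.
have br n : nbound (g n) (droot n T).
  move=> x; rewrite rE; apply: (le_trans (ler_normD _ _)).
  apply: (@le_trans _ _ ((1 + t n * k) * `|x|)); last by apply: ler_wpM2r => //; exact: expR_ge1Dx.
  rewrite mulrDl mul1r lerD2l normrZ gtr0_norm// -mulrA ler_pM2l//.
  exact: log_approx_nbound.
(* Each squaring multiplies the distance by [2 g_i = 2 g_{i-1} / g_i], so the product over [n]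
   squarings is [2^n g_0 / g_n]. *)
have step n d : 0 <= d -> (forall x, `|droot n T x - E n x| <= d * `|x|) ->
    forall x, `|T x - E 0%N x| <= 2 ^+ n * (g 0%N / g n) * d * `|x|.
  elim: n d => [|n IHn] d d0 h x.
    by rewrite expr0 mul1r divff ?gt_eqF// mul1r; exact: h.
  have h' y : `|droot n T y - E n y| <= 2 * g n.+1 * d * `|y|.
    rewrite -rootS -EE; apply: nbound_sqr_diff => //; last exact: ltW.
    exact: selfadj_linear (root_selfadj n.+1).
  have d' : 0 <= 2 * g n.+1 * d by rewrite !mulr_ge0// ltW.
  apply: (le_trans (IHn _ d' h' x)); rewrite -(gS n) exprS.
  rewrite le_eqVlt; apply/orP; left; apply/eqP; field.
  by rewrite gt_eqF.
pose C := k ^+ 2 + k ^+ 2 * g 0%N.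
have C0 : 0 <= C.
  by apply: addr_ge0; [exact: sqr_ge0|apply: mulr_ge0; [exact: sqr_ge0|exact: ltW]].
have close n x : `|droot n T x - E n x| <= C * (t n * t n) * `|x|.
  have h1 : `|droot n T x - x - t n *: L x| <= k ^+ 2 * (t n * t n) * `|x|.
    rewrite rE [x + _]addrC addrK -scalerBr normrZ gtr0_norm//.
    rewrite -normrN opprB mulrCA -mulrA ler_pM2l//.
    apply: (le_trans (hL n x)); apply: ler_wpM2r => //; apply: ler_wpM2l; first exact: sqr_ge0.
    rewrite lef_pV2 ?posrE ?exprn_gt0//; apply: ler_weXn2l; rewrite ?ler1n//.
  have h2 : `|E n x - x - t n *: L x| <= k ^+ 2 * g 0%N * (t n * t n) * `|x|.
    apply: (le_trans (exp_op_rem (tk n) (bt n) x)); apply: ler_wpM2r => //.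
    rewrite exprMn (_ : k ^+ 2 * g 0%N * (t n * t n) = t n ^+ 2 * k ^+ 2 * g 0%N); last by ring.
    apply: ler_wpM2l; first by rewrite mulr_ge0 ?sqr_ge0.
    by rewrite ler_expR ler_wpM2r// /t expr0 invr1; exact: t1.
  have -> : droot n T x - E n x = (droot n T x - x - t n *: L x) - (E n x - x - t n *: L x).
    by apply: dot_ext => z; rewrite !dotE; ring.
  apply: (le_trans (ler_normB _ _)); apply: (le_trans (lerD h1 h2)).
  by rewrite -!mulrDl.
have fin n x : `|T x - E 0%N x| <= g 0%N * C * `|x| * t n.
  have d0 : 0 <= C * (t n * t n) by apply: mulr_ge0 => //; apply: mulr_ge0; exact: ltW.
  apply: (le_trans (step n _ d0 (close n) x)).
  have p0 : 0 <= g 0%N * C * `|x| * t n.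
    apply: mulr_ge0; last exact: ltW.
    by apply: mulr_ge0 => //; apply: mulr_ge0 => //; exact: ltW.
  apply: (@le_trans _ _ (g 0%N * C * `|x| * t n * (g n)^-1)); last first.
    by rewrite ler_piMr// invf_le1.
  rewrite le_eqVlt; apply/orP; left; apply/eqP; rewrite /t; field.
  by rewrite gt_eqF//= expf_neq0// pnatr_eq0.
apply/funext => x; apply/esym/eqP; rewrite -subr_eq0.
have -> : exp_op L = E 0%N.
  by rewrite /E; congr exp_op; apply/funext => y; rewrite expr0 invr1 scale1r.
rewrite -normr_le0; apply/ler_addgt0Pr => d d0; rewrite add0r.
have /cvgrPdist_le/(_ d d0)[n _ hn] := cvg_pow2V (g 0%N * C * `|x|).
apply: (le_trans (fin n x)); have := hn n (leqnn n).
by rewrite /= sub0r normrN; exact: le_trans (ler_norm _).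
Qed.

(** [log_exists] makes the description inhabited, and [log_limit] gives the limit formula for
    whichever logarithm it selects. *)
Lemma log_opP : Sym (log_op T) /\ forall x, log_approx T n x @[n --> \oo] --> log_op T x.
Proof.
have [SL EL] : Sym (log_op T) /\ exp_op (log_op T) = T.
  by have [L hL] := log_exists; exact: (@xgetI _ _ [set L | Sym L /\ exp_op L = T] L hL).
by split=> // x; have := log_limit SL (x := x); rewrite EL.
Qed.

End Log.

(** The reference point for the Lipschitz estimate: comparison with [log I = 0] shows that
    [log (I - S)] has finite Hilbert-Schmidt norm. *)
Lemma log_op_id : log_op (idfun : H -> H) = fun=> 0.
Proof.
have bid : bounds 1 1 (idfun : H -> H).
  by split=> [|x]; [split|rewrite dotxx mul1r lexx].
have [_ cL] := log_opP ltr01 (lexx 1) (lexx 1) bid.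
have sid : sqrt_op (idfun : H -> H) = idfun by apply: sqrt_op_eq => //; exact: bounds_SymP bid.
have rid n : droot n (idfun : H -> H) = idfun by elim: n => //= n ->.
apply/funext => x; apply: (cvg_unique _ (cL x)) => //.
rewrite (_ : (fun n => _) = cst 0); first exact: cvg_cst.
by apply/funext => n; rewrite /log_approx rid /= subrr scaler0.
Qed.

(** The identities cancel in the difference of the approximants, which is therefore bounded by [2^n]
    times the distance of the roots, [c_n d / c <= d / c]. *)
Lemma HSbound_log_op (e : nat -> H) (he : orthonormal_basis e) c M d T T' :
    0 < c -> c <= 1 -> 1 <= M -> bounds c M T -> bounds c M T' ->
    HSbound e d (fun x => T x - T' x) ->
  HSbound e (d / c) (fun x => log_op T x - log_op T' x).
Proof.
move=> c0 c1 M1 hT hT' hd.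
have [_ cL] := log_opP c0 c1 M1 hT; have [_ cL'] := log_opP c0 c1 M1 hT'.
apply: (@HSbound_lim _ _ e _ (fun n x => 2 ^+ n *: (droot n T x - droot n T' x))).
  move=> n; have := HSbound_scale (2 ^+ n) (HSbound_iter_sqrt_op he n c0 c1 M1 hT hT' hd).
  apply: HSbound_le; rewrite ger0_norm ?exprn_ge0//.
  have -> : 2 ^+ n * (iter_sqrtR c n / (2 ^+ n * c) * d) = iter_sqrtR c n * (d / c).
    by field; rewrite gt_eqF//= expf_neq0// pnatr_eq0.
  have /andP[q0 q1] := iter_sqrtR_itv n c0 c1.
  by apply: ler_piMl => //; apply: divr_ge0; [case: hd|exact: ltW].
move=> x; rewrite (_ : (fun n => _) = (fun n => log_approx T n x - log_approx T' n x)).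
  by apply: cvgB; [exact: cL|exact: cL'].
by apply/funext => n; rewrite /log_approx -scalerBr opprB addrA subrK.
Qed.

End Logarithm.

(** * Regularization *)

Section Regularization.
Context {R : realType} {H : hilbertType R}.
Implicit Types (a b c d r s M : R) (x y z u v : H).
Implicit Types (A B D F K L Q S T X Y Z : H -> H).

Lemma HS_norm_le a D : HSbound (onb H) a D -> (HS_norm D <= a%:E)%E.
Proof.
move=> [a0 h].
have -> : a%:E = sqrte (a ^+ 2)%:E by rewrite /= sqrtr_sqr ger0_norm.
rewrite lee_sqrt ?lee_fin ?sqr_ge0//.
apply: lime_le; first by apply: is_cvg_nneseries => n _ _; rewrite lee_fin sqr_ge0.
by near=> n; rewrite sumEFin lee_fin.
Unshelve. all: end_near. Qed.

Lemma HSbound_HS_norm a D : HS_norm D = a%:E -> HSbound (onb H) a D.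
Proof.
move=> Da; have a0 : 0 <= a by rewrite -lee_fin -Da sqrte_ge0.
split=> // n; rewrite -lee_fin -sumEFin.
have s0 : (0 <= \sum_(0 <= k <oo) (`|D (onb H k)| ^+ 2)%:E)%E.
  by apply: nneseries_ge0 => k _ _; rewrite lee_fin sqr_ge0.
rewrite EFin_expe -Da sqr_sqrte//.
by apply: nneseries_lim_ge => k _; rewrite lee_fin sqr_ge0.
Qed.

Lemma HS_norm_fin D : (HS_norm D < +oo)%E -> HS_norm D \is a fin_num.
Proof. by move=> h; rewrite ge0_fin_numE// sqrte_ge0. Qed.

Lemma HSbound_HS S : HS S -> exists a, HSbound (onb H) a S.
Proof.
move=> [_ /HS_norm_fin h]; exists (fine (HS_norm S)); apply: HSbound_HS_norm.
by rewrite fineK.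
Qed.

(* Junk case: [onb] is then [0], so that only values at [0] are summed; no
   Gram-Schmidt construction is needed for the theorem. *)
Lemma HS_norm_log_degenerate T : ~ orthonormal_basis (onb H) -> HS_norm (log_op T) = 0%E.
Proof.
move=> nb; have e0 k : onb H k = 0.
  by rewrite /onb xgetPN// => e he; apply: nb; exact: xgetI he.
have L0 : log_op T 0 = 0.
  have [[L hL]|nL] := pselect (exists L, Sym L /\ exp_op L = T).
    have [[[lL _] _] _] :=
      @xgetI _ (fun=> 0) [set L | Sym L /\ exp_op L = T] L hL; exact: lin0 lL.
  by rewrite /log_op xgetPN// => L hL; apply: nL; exists L.
rewrite /HS_norm eseries0 ?sqrte0// => k _ _.
by rewrite e0 L0 normr0 expr0n.
Qed.

Section Compression.
Variables (K S : H -> H).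
Hypotheses (sK : selfadj K) (bK : nbound 1 K) (sS : selfadj S).

(** [I - K S K = (I - K^2) + K (I - S) K] with [0 <= K^2 <= I]: the form lies between the bounds of
    [I - S] and 1, hence the conditions [c <= 1 <= M]. *)
Lemma compression_bounds c M : c <= 1 -> 1 <= M -> bounds c M (idfun \- S) ->
  bounds c M (fun x => x - K (S (K x))).
Proof.
move=> c1 M1 hT; split.
  case: hT => -[c0 cM M0 _ _]; split => // x y.
  by rewrite !dotE sK sS sK.
move=> x; have := hT.2 (K x); rewrite /= !dotBl !dotxx => /andP[h1 h2].
have h : `|K x| ^+ 2 <= `|x| ^+ 2.
  by rewrite ler_pXn2r ?nnegrE//; have := bK x; rewrite mul1r.
have h0 := sqr_ge0 `|K x|.
rewrite [dot (S _) _]dotC in h1 h2.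
have -> : dot (K (S (K x))) x = dot (K x) (S (K x)) by rewrite sK dotC.
have hc : 0 <= (1 - c) * (`|x| ^+ 2 - `|K x| ^+ 2) by rewrite mulr_ge0// subr_ge0.
have hM : 0 <= (M - 1) * (`|x| ^+ 2 - `|K x| ^+ 2) by rewrite mulr_ge0// subr_ge0.
by apply/andP; split; lra.
Qed.

(** [K S K - S = K (S K - S) + (K S - S)], where [S K - S] is the adjoint of [K S - S] and [K] is a
    contraction. *)
Lemma compression_HSbound (e : nat -> H) d : orthonormal_basis e ->
  HSbound e d (fun x => K (S x) - S x) ->
  HSbound e (d + d) (fun x => x - K (S (K x)) - (x - S x)).
Proof.
move=> he h1.
have h2 : HSbound e d (fun x => S (K x) - S x).
  by apply: (HSbound_adj he _ h1) => x y; rewrite !dotE sK !sS.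
have h3 := HSbound_left ler01 bK h2; rewrite mul1r in h3.
have := HSbound_opp (HSbound_add h3 h1).
congr HSbound; apply/funext => x /=.
rewrite (linB (selfadj_linear sK)); apply: dot_ext => z; rewrite !dotE; ring.
Qed.
End Compression.

(** Here [K = Q P] with [Q = A^{1/2}] and [P = (A + g)^{-1/2}]. The third property is the
    quantitative form of [K -> I], on the range of [Q]. *)
Lemma regularization A S g : SymP A -> 0 < g -> linear S ->
  exists K, [/\ selfadj K, nbound 1 K,
    forall z, `|K (sqrt_op A z) - sqrt_op A z| <= Num.sqrt g * `|z| &
    inv_op (sqrt_op (A \+ g \*: idfun)) \o
      ((sqrt_op A \o (idfun \- S) \o sqrt_op A) \+ g \*: idfun) \o
      inv_op (sqrt_op (A \+ g \*: idfun)) = fun x => x - K (S (K x))].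
Proof.
move=> pA g0 lS; have [M M1 hA] := SymP_bounds pA.
have M0 : 0 < M by exact: lt_le_trans M1.
have [[sQ Q0 QQ _] _] := sqrt_opP hA; set Q := sqrt_op A in sQ Q0 QQ *.
rewrite sqrtr0 in Q0.
have bQ := nbound_root hA sQ QQ.
have lQ := selfadj_linear sQ.
have hAg := bounds_shift (ltW g0) hA; rewrite add0r in hAg.
have [[sQ' lowQ' QQ' comm] _] := sqrt_opP hAg.
have bQ' := nbound_root hAg sQ' QQ'.
set Q' := sqrt_op _ in sQ' lowQ' QQ' comm bQ' *.
have lQ' := selfadj_linear sQ'.
have QcQ' x : Q (Q' x) = Q' (Q x).
  apply: comm => //; first exact: nbound_continuous bQ.
  by move=> y /=; rewrite (linD lQ) (linZ lQ) -!QQ.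
have sg0 : 0 < Num.sqrt g by rewrite sqrtr_gt0.
have sgle : Num.sqrt g <= Num.sqrt (M + g) by rewrite ler_wsqrtr// lerDr ltW.
have hQ' : bounds (Num.sqrt g) (Num.sqrt (M + g)) Q'.
  split; first by split; [exact: ltW| |exact: lt_le_trans sgle|].
  by move=> x; rewrite lowQ' nbound_dot.
have [P [sP bP QP PQ]] := inverse_exists sg0 hQ'.
have lP := selfadj_linear sP.
rewrite (inv_op_eq lP bP QP PQ).
have PcQ x : P (Q x) = Q (P x) by rewrite -{1}(QP x) QcQ' PQ.
(* This says [K^2 + g P^2 = I]. It makes [K] a contraction, and it turns the regularized product
   into [I - K S K]. *)
have KE x : P (Q (Q (P x))) + g *: P (P x) = x.
  have /= h := QQ' (P x).
  by rewrite -(linZ lP) -(linD lP) QQ -h PQ QP.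
exists (Q \o P).
have bK : nbound 1 (Q \o P).
  move=> x; rewrite mul1r -(@ler_pXn2r _ 2) ?nnegrE//.
  have := congr1 (dot x) (KE x); rewrite dotDr dotZr -(sP x) -(sP x) -sQ !dotxx => <-.
  by rewrite lerDl mulr_ge0 ?sqr_ge0// ltW.
split => //.
- by move=> x y /=; rewrite sQ sP PcQ.
- move=> z; have -> : (Q \o P) (Q z) - Q z = (Q \o P) (Q z - Q' z).
    by rewrite /= (linB lP) (linB lQ) PQ.
  apply: (le_trans (bK _)); rewrite mul1r.
  (* [(Q + Q')(Q - Q') = - g] since the roots commute, and [Q + Q' >= sqrt g], so
     [|(Q - Q') z| <= sqrt g |z|]. *)
  have low : lbound (Num.sqrt g) (fun x => Q x + Q' x).
    move=> x; rewrite dotDl; have := lowQ' x; have := lbound_dot_ge0 Q0 x; lra.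
  have := lbound_norm (Q z - Q' z) low.
  have -> : Q (Q z - Q' z) + Q' (Q z - Q' z) = - (g *: z).
    rewrite (linB lQ) (linB lQ') QcQ' QQ QQ' /=.
    by apply: dot_ext => u; rewrite !dotE; ring.
  rewrite normrN normrZ gtr0_norm// -{2}(sqr_sqrtr (ltW g0)) expr2 -mulrA.
  by rewrite ler_pM2l.
- apply/funext => x /=; rewrite (linB lQ) (linD lP) (linB lP) (linZ lP).
  rewrite -[X in _ = X - _](KE x).
  by rewrite !PcQ addrAC.
Qed.

End Regularization.

(** * Convergence of the Hilbert-Schmidt norms *)

Theorem theorem6 (R : realType) (H : hilbertType R)
    (H_separable : separable H) (H_infinite : infinite_dimensional H)
    (C0 : H -> H) (C0_pos : SymP C0) (C0_trace : Tr C0)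
    (C0_ker : C0 @^-1` [set 0] = [set 0])
    (A B : H -> H) (A_rel : Tr_rel C0 A) (B_rel : Tr_rel C0 B)
    (S : H -> H) (S_symHS : SymHS_ltI S)
    (B_eq : B = sqrt_op A \o (idfun \- S) \o sqrt_op A) :
  HS_norm (log_op (inv_op (sqrt_op (A \+ gamma \*: idfun))
                     \o (B \+ gamma \*: idfun)
                     \o inv_op (sqrt_op (A \+ gamma \*: idfun))))
    @[gamma --> (0 : R)^'+] --> HS_norm (log_op (idfun \- S)).
Proof.
have [he|nhe] := pselect (orthonormal_basis (onb H)); last first.
  rewrite HS_norm_log_degenerate// (_ : (fun g => _) = cst 0%E); first exact: cvg_cst.
  by apply/funext => g; rewrite HS_norm_log_degenerate.
have [symS HS_S posS] := S_symHS; have [a hS] := HSbound_HS HS_S.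
have sS : selfadj S by case: symS.
have lS := selfadj_linear sS.
have [c [M [c0 c1 M1 hT]]] := pos_op_coercive he sS hS posS.
have [M' _ hC] := SymP_bounds C0_pos; have [[sC _ CC _] _] := sqrt_opP hC.
have bC := nbound_root hC sC CC.
(* [<A x, x>] is the form of [I - S0] at [C0^{1/2} x], so [A x = 0] forces [C0^{1/2} x = 0], hence
   [C0 x = 0]. *)
have [pA A_inj] : SymP A /\ forall x, A x = 0 -> x = 0.
  have [S0 [[_ _ [symT posT]] AE]] := A_rel.
  have [b b1 bT] := Sym_nbound symT.
  have dotA x : dot (A x) x = dot (sqrt_op C0 x) ((idfun \- S0) (sqrt_op C0 x)).
    by rewrite AE /= sC dotC.
  split.
    apply: (@selfadj_SymP _ _ _ (Num.sqrt M' * (b * Num.sqrt M'))).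
    - by move=> x y; rewrite AE /= !sC; case: symT => _ /(_ (sqrt_op C0 x)) /= ->; rewrite sC.
    - move=> x; rewrite AE -!mulrA; apply: (le_trans (bC _)); rewrite ler_wpM2l ?sqrtr_ge0//.
      apply: (le_trans (bT _)); rewrite ler_wpM2l ?(le_trans ler01 b1)//.
    - move=> x; rewrite mul0r dotA; have [->|u0] := eqVneq (sqrt_op C0 x) 0.
        by rewrite dot0l.
      exact/ltW/posT.
  move=> x Ax; have Cx : sqrt_op C0 x = 0.
    by apply/eqP/negPn/negP => /posT; rewrite -dotA Ax dot0l ltxx.
  have : (C0 @^-1` [set 0]) x by rewrite /= -CC Cx (lin0 (selfadj_linear sC)).
  by rewrite C0_ker.
have [MA _ hA] := SymP_bounds pA; have [[sQ Q0 QQ _] _] := sqrt_opP hA.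
rewrite sqrtr0 in Q0.
have pQ : SymP (sqrt_op A) := selfadj_SymP sQ (nbound_root hA sQ QQ) Q0.
have Q_inj x : sqrt_op A x = 0 -> x = 0.
  by move=> Qx; apply: A_inj; rewrite -QQ Qx (lin0 (selfadj_linear sQ)).
have dQ := dense_range pQ Q_inj.
set N := HS_norm (log_op (idfun \- S)).
(* [I - S] and [I] both lie between [c] and [M] and differ by [- S], so the Lipschitz estimate
   applies against [log I = 0]. *)
have N_fin : N \is a fin_num.
  apply: HS_norm_fin; apply: (@le_lt_trans _ _ (a / c)%:E); last exact: ltry.
  apply: HS_norm_le.
  have bid : bounds c M (idfun : H -> H).
    split=> [|x]; first by split=> //; [exact: ltW|exact: le_trans M1|exact: lt_le_trans M1].
    by rewrite dotxx ler_piMl ?sqr_ge0//= ler_peMl ?sqr_ge0.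
  have := HSbound_log_op he c0 c1 M1 hT bid (d := a).
  rewrite log_op_id (_ : (fun x => _ - (fun=> 0) x) = log_op (idfun \- S)).
    apply; rewrite (_ : (fun x => _) = fun x => - S x); first exact: HSbound_opp.
    by apply/funext => x; rewrite /= addrAC subrr add0r.
  by apply/funext => x; rewrite subr0.
pose f (g : R) := HS_norm (log_op (inv_op (sqrt_op (A \+ g \*: idfun))
                     \o (B \+ g \*: idfun) \o inv_op (sqrt_op (A \+ g \*: idfun)))).
have close d : 0 < d -> \forall g \near (0 : R)^'+,
    f g \is a fin_num /\ `|fine N - fine (f g)| <= d.
  (* The tolerance [c d / 2] is doubled by the two-sided compression and divided by [c] by the
     logarithm, which leaves [d]. *)
  move=> d0; have d2 : 0 < c * d / 2 by rewrite divr_gt0 ?mulr_gt0.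
  have [t t0 ht] := HSbound_small_of_dense dQ hS d2.
  near=> g.
  have g0 : 0 < g by near: g; exact: nbhs_right_gt.
  have gt : Num.sqrt g <= t.
    rewrite -[leRHS]gtr0_norm// -sqrtr_sqr ler_wsqrtr//.
    by near: g; apply: nbhs_right_le; exact: exprn_gt0.
  have [K [sK bK KQ TE]] := regularization pA g0 lS.
  rewrite /f B_eq TE.
  have hTg := compression_bounds sK bK sS c1 M1 hT.
  have lK := selfadj_linear sK.
  have hKS : HSbound (onb H) (c * d / 2) (fun x => K (S x) - S x).
    apply: (ht (fun x => K x - x)).
    - by move=> b x y; rewrite lK; apply: dot_ext => z; rewrite !dotE; ring.
    - by move=> x; apply: (le_trans (ler_normB _ _)); have := bK x; lra.
    - by move=> z; apply: (le_trans (KQ z)); exact: ler_wpM2r.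
  have := HSbound_log_op he c0 c1 M1 hTg hT (compression_HSbound sK bK sS he hKS).
  have -> : (c * d / 2 + c * d / 2) / c = d by field; rewrite gt_eqF.
  set L := log_op (fun x => _) => hL.
  (* The triangle inequality is used in both directions; the first also shows that the norm of [L]
     is finite, which the second relies on. *)
  have hN : HSbound (onb H) (fine N) (log_op (idfun \- S)).
    by apply: HSbound_HS_norm; rewrite fineK.
  have hLle : HSbound (onb H) (d + fine N) L.
    by have := HSbound_add hL hN; congr HSbound; apply/funext => x; rewrite subrK.
  have L_fin : HS_norm L \is a fin_num.
    by apply: HS_norm_fin; apply: le_lt_trans (HS_norm_le hLle) (ltry _).
  have hL' : HSbound (onb H) (fine (HS_norm L)) L.
    by apply: HSbound_HS_norm; rewrite fineK.
  have hNle : HSbound (onb H) (d + fine (HS_norm L)) (log_op (idfun \- S)).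
    have := HSbound_add (HSbound_opp hL) hL'.
    by congr HSbound; apply/funext => x; rewrite opprB subrK.
  split => //.
  have := HS_norm_le hLle; have := HS_norm_le hNle.
  rewrite -[HS_norm L]fineK// -/N -[N]fineK// !lee_fin /= => h1 h2.
  by rewrite ler_norml; apply/andP; split; lra.
rewrite -(fineK N_fin); apply/fine_cvgP; split.
  by near=> g; have [] : f g \is a fin_num /\ `|fine N - fine (f g)| <= 1 by near: g; exact: close.
apply/cvgrPdist_le => d d0; near=> g.
by have [] : f g \is a fin_num /\ `|fine N - fine (f g)| <= d by near: g; exact: close.
Unshelve. all: end_near. Qed.
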